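(* Let $\Omega$ be a probability distribution on $\mathbb{R}$ with finite moments $m_k=E_{x\sim\Omega}[x^k]$ for $k\le 6$, and suppose $m_1=m_3=0$ and $m_2=1$. For $n\ge 0$ let $f_6(n)=E[\det(M)^6]$, where $M$ is an $n\times n$ matrix whose entries are drawn independently from $\Omega$ (with $f_6(0)=1$). Then, as formal power series in $t$, \[ F_6(t):=\sum_{n=0}^\infty\frac{t^n}{(n!)^2} f_6(n) = \frac{e^{t \left(m_6-15 m_4 + 30\right)}}{48 \left(1+3t - m_4 t\right)^{15}} \sum _{i=0}^{\infty } \frac{(1+i) (2+i) (4+i)!\, t^i}{\left(1+3t -m_4 t\right)^{3 i}}. \]
   Context: $m_k$ denotes the $k$-th moment of $\Omega$. The right-hand side is interpreted as a formal power series in $t$ (each summand $t^i(1+3t-m_4t)^{-3i}$ has order at least $i$, so the sum converges formally). *)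

(* Defs.v *)
From HB Require Import structures.
From mathcomp Require Import all_boot all_order all_algebra.
From mathcomp Require Import all_classical all_reals all_analysis.

Set SsrOldRewriteGoalsOrder.
Set Implicit Arguments.
Unset Strict Implicit.
Unset Printing Implicit Defensive.

Import Order.TTheory GRing.Theory Num.Theory.
Import numFieldNormedType.Exports.

Local Open Scope classical_set_scope.
Local Open Scope ring_scope.

(* A record, not an alias of nat -> R: function types already carry the
   pointwise ring structure. *)
Record fps (R : Type) := Fps { fps_coef :> nat -> R }.

HB.instance Definition _ (R : Type) := gen_eqMixin (fps R).
HB.instance Definition _ (R : Type) := gen_choiceMixin (fps R).

Lemma fpsP (R : Type) (f g : fps R) : (forall n, f n = g n) -> f = g.
Proof. by case: f g => [f] [g] fg; congr Fps; exact/funext. Qed.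

Section FpsZmodule.
Variable R : zmodType.
Implicit Types f g : fps R.

Definition fps_zero : fps R := Fps (fun=> 0).
Definition fps_opp f : fps R := Fps (fun n => - f n).
Definition fps_add f g : fps R := Fps (fun n => f n + g n).

Fact fps_addA : associative fps_add.
Proof. by move=> f g h; apply: fpsP => n /=; rewrite addrA. Qed.
Fact fps_addC : commutative fps_add.
Proof. by move=> f g; apply: fpsP => n /=; rewrite addrC. Qed.
Fact fps_add0 : left_id fps_zero fps_add.
Proof. by move=> f; apply: fpsP => n /=; rewrite add0r. Qed.
Fact fps_addN : left_inverse fps_zero fps_opp fps_add.
Proof. by move=> f; apply: fpsP => n /=; rewrite addNr. Qed.

HB.instance Definition _ := GRing.isZmodule.Build (fps R)
  fps_addA fps_addC fps_add0 fps_addN.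

Lemma coef_fps0 n : (0 : fps R) n = 0. Proof. by []. Qed.
Lemma coef_fpsD f g n : (f + g) n = f n + g n. Proof. by []. Qed.
Lemma coef_fpsN f n : (- f) n = - f n. Proof. by []. Qed.
Lemma coef_fpsB f g n : (f - g) n = f n - g n. Proof. by []. Qed.

Lemma coef_fps_sum (I : Type) (r : seq I) (p : pred I) (s : I -> fps R) n :
  (\sum_(i <- r | p i) s i) n = \sum_(i <- r | p i) s i n.
Proof. by elim/big_rec2: _ => // i x y _ <-. Qed.

(* The formal sum of a family in which s i has order at least i; only the
   first n.+1 terms then contribute to the coefficient of degree n. *)
Definition fps_sum (s : nat -> fps R) : fps R :=
  Fps (fun n => \sum_(i < n.+1) s i n).

Lemma fps_sum_stationary (s : nat -> fps R) :
    (forall i n, (n < i)%N -> s i n = 0) ->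
  forall n N, (n < N)%N -> (\sum_(i < N) s i) n = fps_sum s n.
Proof.
move=> s0 n N nN; rewrite coef_fps_sum /= -(subnKC nN) big_split_ord /=.
by rewrite [X in _ + X]big1 ?addr0// => i _; rewrite s0// addSn ltnS leq_addr.
Qed.

End FpsZmodule.

Section FpsRing.
Variable R : comNzRingType.
Implicit Types f g : fps R.

Definition fps_one : fps R := Fps (fun n => (n == 0)%:R).
Definition fps_mul f g : fps R :=
  Fps (fun n => \sum_(i < n.+1) f i * g (n - i)%N).
Definition fps_scale (a : R) f : fps R := Fps (fun n => a * f n).

Let coef_mul_rev f g n : fps_mul f g n = \sum_(i < n.+1) f (n - i)%N * g i.
Proof.
rewrite /= (reindex_inj rev_ord_inj) /=; apply: eq_bigr => i _.
by rewrite subSS subKn// -ltnS.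
Qed.

Fact fps_mulC : commutative fps_mul.
Proof.
move=> f g; apply: fpsP => n; rewrite coef_mul_rev /=.
by apply: eq_bigr => i _; rewrite mulrC.
Qed.

Fact fps_mulA : associative fps_mul.
Proof.
move=> f g h; apply: fpsP => n; rewrite [in RHS]coef_mul_rev /=.
pose c j k := f j * (g (n - j - k)%N * h k).
transitivity (\sum_(j < n.+1) \sum_(k < n.+1 | (k <= n - j)%N) c j k).
  apply: eq_bigr => /= j _.
  rewrite [X in _ * X](coef_mul_rev g h (n - j)) big_distrr /=.
  by rewrite (big_ord_narrow_leq (leq_subr _ _)).
rewrite (exchange_big_dep predT) //=; apply: eq_bigr => k _.
transitivity (\sum_(j < n.+1 | (j <= n - k)%N) c j k).
  apply: eq_bigl => j; rewrite -ltnS -(ltnS j) -!subSn ?leq_ord//.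
  by rewrite -subn_gt0 -(subn_gt0 j) -!subnDA addnC.
rewrite (big_ord_narrow_leq (leq_subr _ _)) /= big_distrl /=.
by apply: eq_bigr => j _; rewrite /c -!subnDA addnC mulrA.
Qed.

Fact fps_mul1 : left_id fps_one fps_mul.
Proof.
move=> f; apply: fpsP => n /=; rewrite big_ord_recl /= mul1r subn0.
by rewrite big1 ?addr0// => i _; rewrite mul0r.
Qed.

Fact fps_mulDl : left_distributive fps_mul +%R.
Proof.
move=> f g h; apply: fpsP => n /=; rewrite -big_split /=.
by apply: eq_bigr => i _; rewrite mulrDl.
Qed.

Fact fps_one_neq0 : fps_one != 0.
Proof.
apply/eqP => /(congr1 (fun f : fps R => f 0)) /= /eqP.
by rewrite oner_eq0.
Qed.

HB.instance Definition _ := GRing.Zmodule_isComNzRing.Build (fps R)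
  fps_mulA fps_mulC fps_mul1 fps_mulDl fps_one_neq0.

Fact fps_scaleA a b f : fps_scale a (fps_scale b f) = fps_scale (a * b) f.
Proof. by apply: fpsP => n /=; rewrite mulrA. Qed.
Fact fps_scale1 : left_id 1 fps_scale.
Proof. by move=> f; apply: fpsP => n /=; rewrite mul1r. Qed.
Fact fps_scaleDr : right_distributive fps_scale +%R.
Proof. by move=> a f g; apply: fpsP => n /=; rewrite mulrDr. Qed.
Fact fps_scaleDl f : {morph fps_scale^~ f : a b / a + b}.
Proof. by move=> a b; apply: fpsP => n /=; rewrite mulrDl. Qed.

HB.instance Definition _ := GRing.Zmodule_isLmodule.Build R (fps R)
  fps_scaleA fps_scale1 fps_scaleDr fps_scaleDl.

Fact fps_scaleAl (a : R) f g : a *: (f * g) = a *: f * g.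
Proof.
by apply: fpsP => n /=; rewrite big_distrr; apply: eq_bigr => i _ /=; rewrite mulrA.
Qed.

HB.instance Definition _ := GRing.Lmodule_isLalgebra.Build R (fps R) fps_scaleAl.
HB.instance Definition _ := GRing.Lalgebra_isComAlgebra.Build R (fps R).

Lemma coef_fps1 n : (1 : fps R) n = (n == 0)%:R. Proof. by []. Qed.
Lemma coef_fpsM f g n : (f * g) n = \sum_(i < n.+1) f i * g (n - i)%N.
Proof. by []. Qed.
Lemma coef_fpsZ a f n : (a *: f) n = a * f n. Proof. by []. Qed.

Definition fpsX : fps R := Fps (fun n => (n == 1)%:R).

Lemma coef0_fpsM f g : (f * g) 0 = f 0 * g 0.
Proof. by rewrite coef_fpsM big_ord1. Qed.

Lemma coef_fpsX_lt f k n : f 0 = 0 -> (n < k)%N -> (f ^+ k) n = 0.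
Proof.
move=> f0; elim: k n => // k IHk n; rewrite ltnS exprS coef_fpsM => nk.
rewrite big1// => -[[|i] ilt] _ /=; first by rewrite f0 mul0r.
by rewrite IHk ?mulr0//; move: ilt; case: n nk => // n nk _; rewrite subSS (leq_ltn_trans (leq_subr _ _)).
Qed.

Lemma coef_fpsXnM_lt f k n : (n < k)%N -> (fpsX ^+ k * f) n = 0.
Proof.
move=> nk; rewrite coef_fpsM big1// => i _.
by rewrite coef_fpsX_lt ?mul0r// (leq_ltn_trans _ nk)// -ltnS.
Qed.

End FpsRing.

Section FpsUnitRing.
Variable R : comUnitRingType.
Implicit Types f g : fps R.

Definition fps_unit : {pred fps R} := fun f => f 0 \is a GRing.unit.

(* The geometric series of 1 - f / f(0), divided by f(0). *)
Definition fps_inv f : fps R :=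
  if f 0 \is a GRing.unit
  then (f 0)^-1 *: fps_sum (fun k => (1 - (f 0)^-1 *: f) ^+ k) else f.

Fact fps_mulVx : {in fps_unit, left_inverse 1 fps_inv *%R}.
Proof.
move=> f; rewrite unfold_in => fu; rewrite /fps_inv fu.
rewrite -scalerAl scalerAr; set u := _ *: f; set h := 1 - u.
have h0 : h 0 = 0 by rewrite /h coef_fpsB coef_fps1 coef_fpsZ mulVr// subrr.
apply: fpsP => n.
transitivity (((\sum_(i < n.+1) h ^+ i) * u) n).
  rewrite !coef_fpsM; apply: eq_bigr => i _; congr (_ * _).
  rewrite fps_sum_stationary// => k m; exact: coef_fpsX_lt.
have -> : u = 1 - h by rewrite /h opprB addrC subrK.
rewrite mulrC -[X in (X * _)]opprB mulNr -subrX1 opprB.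
by rewrite coef_fpsB (coef_fpsX_lt h0 (ltnSn n)) subr0.
Qed.

Fact fps_unitPl f g : g * f = 1 -> fps_unit f.
Proof.
move=> /(congr1 (fun h : fps R => h 0)); rewrite coef0_fpsM coef_fps1 => gf.
by apply/unitrPr; exists (g 0); rewrite mulrC.
Qed.

Fact fps_inv_out : {in [predC fps_unit], fps_inv =1 id}.
Proof. by move=> f; rewrite inE unfold_in /fps_inv => /negbTE ->. Qed.

HB.instance Definition _ := GRing.ComNzRing_hasMulInverse.Build (fps R)
  fps_mulVx fps_unitPl fps_inv_out.

Lemma fps_unitE f : (f \is a GRing.unit) = (f 0 \is a GRing.unit).
Proof. by []. Qed.

(* Meaningful when f has constant coefficient 0. *)
Definition fps_exp f : fps R := fps_sum (fun k => (k`!%:R)^-1 *: f ^+ k).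

End FpsUnitRing.

Arguments fpsX {R}.

Definition moment (R : realType) (Omega : probability R R) (k : nat) : R :=
  fine 'E_Omega[fun x : R => x ^+ k].

Definition mutually_independent d (T : measurableType d) (R : realType)
    (P : probability T R) (I : finType) (X : I -> {RV P >-> R}) : Prop :=
  forall (J : {set I}) (B : I -> set R), (forall i, measurable (B i)) ->
  P (\bigcap_(i in [set` J]) (X i @^-1` B i)) =
    (\prod_(i in J) P (X i @^-1` B i))%E.

Definition det_moment d (T : measurableType d) (R : realType)
    (P : probability T R) n (M : 'I_n -> 'I_n -> {RV P >-> R}) (k : nat) : R :=
  fine 'E_P[fun w => \det (\matrix_(i, j) M i j w) ^+ k].

(* Main.v *)
Require Import Defs.
From mathcomp Require Import all_boot all_order all_algebra perm ring.
From mathcomp Require Import all_classical all_reals all_analysis.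
From mathcomp Require Import measurable_realfun zify.

(* Expand E[det^6] over six-tuples of permutations: every entry occurs with
   exponent at most 6, so only the moments matter, and the law may be replaced by
   any signed combination of finitely many point masses with the same moments
   (a weight function w on a finite set of points v).  Averages become finite
   sums, and the weights may depend polynomially on a parameter s joining the
   Gaussian moments (s = 0) to the given ones (s = 1).

   Write k4 = m4 - 3 and k6 = m6 - 15 m4 + 30 for the cumulants, C_ij for the
   cofactors, and f(n) = E[det^6], A(n) = sum E[C_ij^2 det^4],
   B(n) = sum E[C_ij^4 det^2].  Laplace expansion and integration by parts in a
   single entry give, along the path (k4 s, k6 s),
     n f(n) = 5 A(n) + 10 k4 s B(n) + k6 s n^2 f(n-1),
     B(n) = n^2 (f(n-1) + A(n-1)),
     df(n)/ds = 15 k4 B(n) + k6 n^2 f(n-1).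
   They determine f(n) from its value at s = 0, and the coefficients of s^l
   satisfy the recursion of e^(k6 t) / (1 - k4 t)^(15+3i).

   For Gaussian moments, E[det (Y Y^T)^3] is computed row by row: as a function of
   a new row x the Gram determinant is a quadratic form x N x^T, where N is a
   multiple of the projection orthogonal to the previous rows. *)

Set Implicit Arguments.
Unset Strict Implicit.
Unset Printing Implicit Defensive.

Import Order.TTheory GRing.Theory Num.Theory.
Import numFieldNormedType.Exports.
Local Open Scope classical_set_scope.
Local Open Scope ring_scope.

(** * Averages over finitely supported signed product measures *)

Definition set_coord (I : eqType) (K : Type) (y : I -> K) (i : I) (c : K) : I -> K :=
  fun j => if j == i then c else y j.

Section Average.
Variables (K : comNzRingType) (A : finType) (v : A -> K).
Implicit Types (w : A -> K).

Definition wsum w (p : K -> K) : K := \sum_a w a * p (v a).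

(** Expectation over independent coordinates whose common signed law puts mass [w a] at [v a]. A
    commutative ring [K] suffices, so the weights can be polynomials in the path parameter. *)
Definition avg w (I : finType) (phi : (I -> K) -> K) : K :=
  \sum_(x : {ffun I -> A}) (\prod_i w (x i)) * phi (fun i => v (x i)).

Lemma eq_avg w (I : finType) (phi psi : (I -> K) -> K) :
  phi =1 psi -> avg w phi = avg w psi.
Proof. by move=> e; apply: eq_bigr => x _; rewrite e. Qed.

Lemma avgD w (I : finType) (phi psi : (I -> K) -> K) :
  avg w (fun y => phi y + psi y) = avg w phi + avg w psi.
Proof. by rewrite -big_split; apply: eq_bigr => x _; rewrite mulrDr. Qed.

Lemma avgZ w (I : finType) c (phi : (I -> K) -> K) :
  avg w (fun y => c * phi y) = c * avg w phi.
Proof. by rewrite mulr_sumr; apply: eq_bigr => x _; rewrite mulrCA. Qed.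

Lemma avg_sum w (I J : finType) (Q : pred J) (phi : J -> (I -> K) -> K) :
  avg w (fun y => \sum_(j | Q j) phi j y) = \sum_(j | Q j) avg w (phi j).
Proof.
by rewrite exchange_big; apply: eq_bigr => x _; rewrite mulr_sumr.
Qed.

(** Swapping the old value of coordinate [i] with the resampled one moves [w'] onto that coordinate,
    and the freed variable sums to 1. For [w' = w] this is Fubini in one coordinate; other [w']
    produce the terms of a product rule in the weights. *)
Lemma avg_set_coord_gen w w' (I : finType) (i : I) (phi : (I -> K) -> K) :
    \sum_a w a = 1 ->
  avg w (fun y => wsum w' (fun c => phi (set_coord y i c))) =
  \sum_(x : {ffun I -> A})
    (w' (x i) * \prod_(k | k != i) w (x k)) * phi (fun k => v (x k)).
Proof.
move=> w1.
pose sw (p : {ffun I -> A} * A) : {ffun I -> A} * A :=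
  ([ffun k => if k == i then p.2 else p.1 k], p.1 i).
have swK : involutive sw.
  case=> x a; rewrite /sw /= !ffunE eqxx; congr (_, _).
  by apply/ffunP => k; rewrite !ffunE; case: eqP => // ->.
transitivity (\sum_(p : {ffun I -> A} * A) (w p.2 * w' (p.1 i) *
    \prod_(k | k != i) w (p.1 k)) * phi (fun k => v (p.1 k))).
  rewrite [RHS](reindex_inj (inv_inj swK)) /=.
  rewrite -(pair_bigA _ (fun (x : {ffun I -> A}) a => w (x i) * w' ([ffun k => if k == i then a
    else x k] i) * \prod_(k | k != i) w ([ffun k => if k == i then a else x k] k)
    * phi (fun k => v ([ffun k => if k == i then a else x k] k)))) /=.
  apply: eq_bigr => x _; rewrite /wsum mulr_sumr; apply: eq_bigr => a _.
  rewrite ffunE eqxx (bigD1 i) //=.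
  rewrite (_ : (fun k => v ([ffun k => if k == i then a else x k] k)) =
    set_coord (fun k => v (x k)) i (v a)); last first.
    by apply/funext => k; rewrite /set_coord ffunE; case: eqP.
  rewrite [X in _ = _ * X * _](eq_bigr (fun k => w (x k))) ?mulrA; last first.
    by move=> k /negPf ki; rewrite ffunE ki.
  by congr (_ * _); rewrite mulrAC.
rewrite -(pair_bigA _ (fun (x : {ffun I -> A}) a => w a * w' (x i) *
   (\prod_(k | k != i) w (x k)) * phi (fun k => v (x k)))) /=.
apply: eq_bigr => x _; rewrite -[RHS]mul1r -w1 mulr_suml.
by apply: eq_bigr => a _; rewrite !mulrA.
Qed.

Lemma avg_set_coord w (I : finType) (i : I) (phi : (I -> K) -> K) :
    \sum_a w a = 1 ->
  avg w (fun y => wsum w (fun c => phi (set_coord y i c))) = avg w phi.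
Proof.
move=> w1; rewrite avg_set_coord_gen //.
by apply: eq_bigr => x _; rewrite [in RHS](bigD1 i).
Qed.

(** Marginalization: the coordinates outside the image of [h] have total mass 1. *)
Lemma avg_reindex w (I J : finType) (h : J -> I) (phi : (J -> K) -> K) :
    \sum_a w a = 1 -> injective h ->
  avg w (fun y => phi (y \o h)) = avg w phi.
Proof.
move=> w1 hI.
pose res (x : {ffun I -> A}) : {ffun J -> A} := [ffun j => x (h j)].
rewrite /avg (partition_big res predT) //=; apply: eq_bigr => z _.
under eq_bigr => x /eqP xz.
  rewrite (_ : _ \o h = fun j => v (z j)); last first.
    by apply/funext => j; rewrite -xz ffunE.
  over.
rewrite -mulr_suml; congr (_ * _).
(* The fibre of [res] over [z] is a product set: coordinate [h j] is forced to be [z j], all others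
   are free. Hence the sum over it factors. *)
pose Q i : pred A := fun a => [forall j, (h j == i) ==> (a == z j)].
transitivity (\sum_(x in family Q) \prod_i w (x i)).
  apply: eq_bigl => x; apply/eqP/familyP => [xz i|xQ].
    by apply/forallP => j; apply/implyP => /eqP <-; rewrite -xz ffunE.
  by apply/ffunP => j; rewrite ffunE;
    have /forallP/(_ j)/implyP/(_ (eqxx _))/eqP := xQ (h j).
rewrite -(bigA_distr_big_dep _ (fun i a => w a)) (bigID (mem (codom h))) /=.
rewrite [X in _ * X]big1 ?mulr1; last first.
  move=> i ih; rewrite -[RHS]w1; apply: eq_bigl => a.
  by apply/forallP => j; apply/implyP => /eqP ji; rewrite -ji codom_f in ih.
rewrite (reindex_omap h (fun i => [pick j | h j == i])); last first.
  move=> i /codomP[j ->]; case: pickP => [k /eqP <- //|/(_ j)].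
  by rewrite eqxx.
apply: eq_big => [j|j _].
  rewrite codom_f /=; case: pickP => [k /eqP/hI -> |/(_ j)]; last by rewrite eqxx.
  by rewrite eqxx.
rewrite (big_pred1 (z j)) // => a; apply/forallP/eqP => [/(_ j)|-> k].
  by rewrite eqxx => /eqP.
by apply/implyP => /eqP/hI ->.
Qed.

End Average.

(** * Cofactor moments *)

Lemma cofactor_eq_row (K : comNzRingType) n (X Y : 'M[K]_n) i j :
  (forall k l, k != i -> X k l = Y k l) -> cofactor X i j = cofactor Y i j.
Proof.
move=> e; rewrite /cofactor; congr (_ * \det _).
by apply/matrixP => k l; rewrite !mxE e // eq_sym neq_lift.
Qed.

(** The determinant is affine in one entry, with the cofactor as slope; both sides are its
    intercept. *)
Lemma det_eq_entry (K : comNzRingType) n (X Y : 'M[K]_n) i j :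
  (forall k l, (k, l) != (i, j) -> X k l = Y k l) ->
  \det X - X i j * cofactor X i j = \det Y - Y i j * cofactor Y i j.
Proof.
move=> e; rewrite (expand_det_row X i) (expand_det_row Y i).
rewrite [\sum_l X i l * _](bigD1 j) // [\sum_l Y i l * _](bigD1 j) //=.
rewrite [X in X - _]addrC addrK [X in _ = X - _]addrC addrK.
apply: eq_bigr => l lj; rewrite (e i l) ?xpair_eqE ?eqxx ?(negPf lj) //.
congr (_ * _); apply: cofactor_eq_row => k l' ki.
by apply: e; rewrite xpair_eqE (negPf ki).
Qed.

Section Moments.
Variables (K : comNzRingType) (A : finType) (v : A -> K).

(** The total mass [m0] is kept as a parameter because tangent directions to the path have mass
    0. *)
Definition moments7 (w : A -> K) (m0 m2 m4 m6 : K) := forall k, (k <= 6)%N ->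
  \sum_a w a * v a ^+ k = nth 0 [:: m0; 0; m2; 0; m4; 0; m6] k.

Lemma wsum_poly w m0 m2 m4 m6 (p : K -> K) c0 c1 c2 c3 c4 c5 c6 :
  moments7 w m0 m2 m4 m6 ->
  (forall a, p a = c0 + c1 * a + c2 * a ^+ 2 + c3 * a ^+ 3 + c4 * a ^+ 4
       + c5 * a ^+ 5 + c6 * a ^+ 6) ->
  wsum v w p = c0 * m0 + c2 * m2 + c4 * m4 + c6 * m6.
Proof.
move=> mw pE; rewrite /wsum.
have key k c : (k <= 6)%N -> \sum_a w a * (c * v a ^+ k) =
    c * nth 0 [:: m0; 0; m2; 0; m4; 0; m6] k.
  by move=> k6; rewrite -mw // mulr_sumr; apply: eq_bigr => a _; rewrite mulrCA.
transitivity (\sum_(k < 7) \sum_a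
    w a * (nth 0 [:: c0; c1; c2; c3; c4; c5; c6] k * v a ^+ k)).
  rewrite exchange_big; apply: eq_bigr => a _; rewrite pE.
  by rewrite !big_ord_recl big_ord0 /=; ring.
rewrite (eq_bigr _ (fun (k : 'I_7) _ => key k _ (ltn_ord k))).
by rewrite !big_ord_recl big_ord0 /=; ring.
Qed.

Lemma moments7_sum w m0 m2 m4 m6 : moments7 w m0 m2 m4 m6 -> \sum_a w a = m0.
Proof.
by move=> /(_ 0%N isT) /= <-; apply: eq_bigr => a _; rewrite expr0 mulr1.
Qed.

Lemma wsum_const w e : \sum_a w a = 1 -> wsum v w (fun=> e) = e.
Proof. by move=> w1; rewrite /wsum -mulr_suml w1 mul1r. Qed.

Lemma eq_avg_set w (I : finType) (i : I) (phi psi : (I -> K) -> K) :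
  \sum_a w a = 1 ->
  (forall y, wsum v w (fun a => phi (set_coord y i a)) =
             wsum v w (fun a => psi (set_coord y i a))) ->
  avg v w phi = avg v w psi.
Proof.
by move=> w1 e; rewrite -(avg_set_coord v i phi w1) -(avg_set_coord v i psi w1);
  exact: eq_avg.
Qed.

Variables (w : A -> K) (k4 k6 : K).
Hypothesis mw : moments7 w 1 1 (3 + k4) (15 + 15 * k4 + k6).

Let w1 : \sum_a w a = 1. Proof. exact: moments7_sum mw. Qed.

(* [E[x p(x)] = E[p'] + k4/6 E[p'''] + k6/120 E[p^(5)]] for [p x = (c x + r)^5]. *)
Lemma wsum_parts5 c r : wsum v w (fun a => a * c * (a * c + r) ^+ 5) =
  wsum v w (fun a => 5 * (c ^+ 2 * (a * c + r) ^+ 4)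
    + 10 * k4 * (c ^+ 4 * (a * c + r) ^+ 2) + k6 * c ^+ 6).
Proof.
rewrite (wsum_poly (c0 := 0) (c1 := c * r ^+ 5) (c2 := 5 * c ^+ 2 * r ^+ 4)
  (c3 := 10 * c ^+ 3 * r ^+ 3) (c4 := 10 * c ^+ 4 * r ^+ 2)
  (c5 := 5 * c ^+ 5 * r) (c6 := c ^+ 6) mw); last by move=> a; ring.
rewrite (wsum_poly
  (c0 := 5 * c ^+ 2 * r ^+ 4 + 10 * k4 * c ^+ 4 * r ^+ 2 + k6 * c ^+ 6)
  (c1 := 20 * c ^+ 3 * r ^+ 3 + 20 * k4 * c ^+ 5 * r)
  (c2 := 30 * c ^+ 4 * r ^+ 2 + 10 * k4 * c ^+ 6)
  (c3 := 20 * c ^+ 5 * r) (c4 := 5 * c ^+ 6)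
  (c5 := 0) (c6 := 0) mw); last by move=> a; ring.
by ring.
Qed.

(** Integration by parts for a linear function, where the higher cumulants do not enter. *)
Lemma wsum_parts1 c r e : wsum v w (fun a => a * c * (a * c + r) * e) = c ^+ 2 * e.
Proof.
rewrite (wsum_poly (c0 := 0) (c1 := c * r * e) (c2 := c ^+ 2 * e)
  (c3 := 0) (c4 := 0) (c5 := 0) (c6 := 0) mw); last by move=> a; ring.
by ring.
Qed.

Definition mat m n (y : 'I_m * 'I_n -> K) : 'M[K]_(m, n) := \matrix_(i, j) y (i, j).

Lemma mat_set m n (y : 'I_m * 'I_n -> K) i j a : mat (set_coord y (i, j) a) i j = a.
Proof. by rewrite mxE /set_coord eqxx. Qed.

Lemma mat_set_neq m n (y : 'I_m * 'I_n -> K) p a k l :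
  (k, l) != p -> mat (set_coord y p a) k l = mat y k l.
Proof. by move=> e; rewrite !mxE /set_coord (negPf e). Qed.

Lemma cofactor_set_row n (y : 'I_n * 'I_n -> K) i j j' a :
  cofactor (mat (set_coord y (i, j) a)) i j' = cofactor (mat y) i j'.
Proof.
apply: cofactor_eq_row => k l ki.
by rewrite mat_set_neq // xpair_eqE (negPf ki).
Qed.

Lemma det_set n (y : 'I_n * 'I_n -> K) i j a :
  \det (mat (set_coord y (i, j) a)) =
  a * cofactor (mat y) i j + (\det (mat y) - mat y i j * cofactor (mat y) i j).
Proof.
have /det_eq_entry := fun k l kl => @mat_set_neq _ _ y (i, j) a k l kl.
by rewrite mat_set cofactor_set_row => <-; rewrite addrC subrK.
Qed.

(** [detm6], [cof2] and [cof4] are the f, A and B of the overview. *)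
Definition detm6 n := avg v w (fun y : 'I_n * 'I_n -> K => \det (mat y) ^+ 6).
Definition cof2 n := \sum_(i < n) \sum_(j < n)
  avg v w (fun y => cofactor (mat y) i j ^+ 2 * \det (mat y) ^+ 4).
Definition cof4 n := \sum_(i < n) \sum_(j < n)
  avg v w (fun y => cofactor (mat y) i j ^+ 4 * \det (mat y) ^+ 2).

Lemma avg_minor n (i j : 'I_n) (phi : ('I_n.-1 * 'I_n.-1 -> K) -> K) :
  avg v w (fun y : 'I_n * 'I_n -> K => phi (fun p => y (lift i p.1, lift j p.2)))
  = avg v w phi.
Proof.
rewrite -(avg_reindex v (h := fun p => (lift i p.1, lift j p.2)) phi w1) //.
move=> [a b] [c d] e; congr (_, _).
  exact: (lift_inj (congr1 fst e)).
exact: (lift_inj (congr1 snd e)).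
Qed.

Lemma cofactorX2 n (X : 'M[K]_n) i j :
  cofactor X i j ^+ 2 = \det (row' i (col' j X)) ^+ 2.
Proof.
by rewrite /cofactor exprMn -exprM mulnC exprM sqrrN expr1n expr1n mul1r.
Qed.

Lemma row'_col'_mat n (y : 'I_n * 'I_n -> K) i j :
  row' i (col' j (mat y)) = mat (fun p => y (lift i p.1, lift j p.2)).
Proof. by apply/matrixP => k l; rewrite !mxE. Qed.

Lemma avg_cof6 n (i j : 'I_n) :
  avg v w (fun y => cofactor (mat y) i j ^+ 6) = detm6 n.-1.
Proof.
rewrite /detm6 -(avg_minor i j); apply: eq_avg => y.
by rewrite [LHS](exprM _ 2 3) cofactorX2 -exprM row'_col'_mat.
Qed.

(** One factor of the determinant is expanded along each of the [n] rows; integrating by parts in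
    entry [(i, j)] then differentiates the remaining fifth power, each derivative bringing out a
    cofactor. *)
Lemma detm6_expand n : n%:R * detm6 n =
  5 * cof2 n + 10 * k4 * cof4 n + k6 * (n%:R ^+ 2 * detm6 n.-1).
Proof.
transitivity (\sum_(i < n) \sum_(j < n) avg v w (fun y =>
    5 * (cofactor (mat y) i j ^+ 2 * \det (mat y) ^+ 4)
    + 10 * k4 * (cofactor (mat y) i j ^+ 4 * \det (mat y) ^+ 2)
    + k6 * cofactor (mat y) i j ^+ 6)).
  transitivity (\sum_(i < n) detm6 n).
    by rewrite sumr_const card_ord mulr_natl.
  apply: eq_bigr => i _.
  transitivity (avg v w (fun y => \sum_(j < n)
      mat y i j * cofactor (mat y) i j * \det (mat y) ^+ 5)).
    by apply: eq_avg => y; rewrite -mulr_suml -expand_det_row -exprS.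
  rewrite avg_sum; apply: eq_bigr => j _; apply: (eq_avg_set (i := (i, j)) w1) => y.
  under [in LHS]eq_fun => a do rewrite mat_set cofactor_set_row det_set.
  under [in RHS]eq_fun => a do rewrite cofactor_set_row det_set.
  exact: wsum_parts5.
rewrite /cof2 /cof4.
have -> : k6 * (n%:R ^+ 2 * detm6 n.-1) =
    \sum_(i < n) \sum_(j < n) k6 * detm6 n.-1.
  by rewrite !sumr_const card_ord -mulrnA -[_ *+ (n * n)]mulr_natr natrM; ring.
rewrite [5 * _]mulr_sumr [10 * k4 * _]mulr_sumr -!big_split /=.
apply: eq_bigr => i _.
rewrite [5 * _]mulr_sumr [10 * k4 * _]mulr_sumr -!big_split /=.
apply: eq_bigr => j _.
by rewrite !avgD !avgZ avg_cof6.
Qed.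

(* Deleting columns [i] and [lift i j] in either order leaves the same columns. *)
Lemma lift_liftC n (i : 'I_n) (j : 'I_n.-1) (i' : 'I_n.-1) k :
  lift (lift i j) i' = i -> lift (lift i j) (lift i' k) = lift i (lift j k).
Proof.
move=> /(congr1 val) /= e; apply/val_inj => /=; move: e.
by rewrite /bump; case: (ltngtP _ i) => //= *; lia.
Qed.

(** Column [j] occurs in the first minor but not in the second. Expanding one copy of the first
    along it and integrating by parts in each entry leaves squares of double minors, which are also
    cofactors of the second minor. *)
Lemma avg_cof4_cof2 n (i j : 'I_n) (j0 : 'I_n.-1) :
  avg v w (fun y => cofactor (mat y) i (lift j j0) ^+ 2 * cofactor (mat y) i j ^+ 4)
  = \sum_(i0 < n.-1) avg v w (fun y =>
      cofactor (mat y) i0 j0 ^+ 2 * \det (mat y) ^+ 4).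
Proof.
(* [j1] is the position of column [j] once column [lift j j0] has been deleted. *)
have [j1 _ ej] : exists2 j1, j1 \in predT & lift (lift j j0) j1 = j.
  have /unlift_some[j1 e _] : lift j j0 != j by rewrite eq_sym neq_lift.
  by exists j1.
transitivity (avg v w (fun y => \sum_(i0 < n.-1)
    mat y (lift i i0) j * cofactor (row' i (col' (lift j j0) (mat y))) i0 j1 *
    \det (row' i (col' (lift j j0) (mat y))) *
    \det (row' i (col' j (mat y))) ^+ 4)).
  apply: eq_avg => y; rewrite -!mulr_suml [_ ^+ 4](exprM _ 2 2) !cofactorX2.
  rewrite [_ ^+ 4](exprM _ 2 2); congr (_ * _).
  rewrite expr2; congr (_ * _); rewrite (expand_det_col _ j1).
  by apply: eq_bigr => k _; rewrite !mxE ej.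
rewrite avg_sum; apply: eq_bigr => i0 _.
transitivity (avg v w (fun y =>
    cofactor (row' i (col' j (mat y))) i0 j0 ^+ 2 *
    \det (row' i (col' j (mat y))) ^+ 4)); last first.
  rewrite -(avg_minor i j (fun y => cofactor (mat y) i0 j0 ^+ 2 *
      \det (mat y) ^+ 4)).
  by apply: eq_avg => y; rewrite !row'_col'_mat.
apply: (eq_avg_set (i := (lift i i0, j)) w1) => y.
have e1 a : row' i (col' j (mat (set_coord y (lift i i0, j) a))) =
    row' i (col' j (mat y)).
  apply/matrixP => k l; rewrite !mxE /set_coord xpair_eqE.
  by rewrite [lift j l == j]eq_sym (negPf (neq_lift _ _)) andbF.
pose z p := y (lift i p.1, lift (lift j j0) p.2).
have e2 a : row' i (col' (lift j j0) (mat (set_coord y (lift i i0, j) a))) =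
    mat (set_coord z (i0, j1) a).
  rewrite row'_col'_mat; apply/matrixP => k l.
  rewrite !mxE /set_coord /z -{2}ej !xpair_eqE.
  by rewrite !(inj_eq (@lift_inj _ _)).
under [in LHS]eq_fun => a do rewrite e1 e2 mat_set cofactor_set_row det_set.
under [in RHS]eq_fun => a do rewrite e1.
rewrite wsum_parts1 (wsum_const _ w1); congr (_ * _).
rewrite !cofactorX2; congr (\det _ ^+ 2); apply/matrixP => k l.
by rewrite !mxE /z /= lift_liftC.
Qed.

(** Expand one of the two determinants along row [i], on which the cofactors of that row do not
    depend. Integration by parts leaves a squared cofactor at [(i, j')]: the term [j' = j] is a
    sixth power of a minor, the others sum to [cof2]. *)
Lemma cof4_expand n : cof4 n = n%:R ^+ 2 * (detm6 n.-1 + cof2 n.-1).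
Proof.
transitivity (\sum_(i < n) \sum_(j < n) (detm6 n.-1 + cof2 n.-1)); last first.
  by rewrite !sumr_const card_ord -mulrnA -[_ *+ (n * n)]mulr_natr natrM; ring.
apply: eq_bigr => i _; apply: eq_bigr => j _.
transitivity (avg v w (fun y => \sum_(j' < n)
    mat y i j' * cofactor (mat y) i j' * \det (mat y) * cofactor (mat y) i j ^+ 4)).
  by apply: eq_avg => y; rewrite -!mulr_suml -expand_det_row mulrC expr2.
transitivity (\sum_(j' < n) avg v w (fun y =>
    cofactor (mat y) i j' ^+ 2 * cofactor (mat y) i j ^+ 4)).
  rewrite avg_sum; apply: eq_bigr => j' _.
  apply: (eq_avg_set (i := (i, j')) w1) => y.
  under [in LHS]eq_fun => a do rewrite mat_set !cofactor_set_row det_set.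
  under [in RHS]eq_fun => a do rewrite !cofactor_set_row.
  by rewrite wsum_parts1 (wsum_const _ w1).
rewrite (bigD1_ord j) //= -(avg_cof6 i j); congr (_ + _).
  by apply: eq_avg => y; rewrite -exprD.
rewrite [RHS]exchange_big; apply: eq_bigr => j0 _; exact: avg_cof4_cof2.
Qed.

End Moments.

(** * The Gaussian case *)

(** Multiplication by a block lower triangular matrix built from [\adj S] clears the lower left
    block. Comparing determinants gives the identity times [d ^+ k], which regularity cancels. *)
Lemma det_schur_lreg (K : comNzRingType) k (e : 'M[K]_1) (c : 'rV[K]_k)
    (b : 'cV[K]_k) (S : 'M[K]_k) : GRing.lreg (\det S) ->
  \det (block_mx e c b S) = \det S * e 0 0 - (c *m \adj S *m b) 0 0.
Proof.
set d := \det S => dreg.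
have eM : block_mx e c b S *m block_mx d%:M 0 (- (\adj S *m b)) (\adj S) =
    block_mx (d *: e - c *m \adj S *m b) (c *m \adj S) 0 d%:M.
  rewrite mulmx_block !mulmx0 !add0r mulmxN mulmxA mul_mx_scalar.
  by rewrite mulmxN mulmxA mul_mx_adj mul_scalar_mx mul_mx_scalar subrr.
have dadj : d * \det (\adj S) = d ^+ k.
  by rewrite /d -det_mulmx mul_mx_adj det_scalar.
have := congr1 determinant eM; rewrite det_mulmx det_lblock det_ublock.
rewrite det_scalar1 dadj det_scalar det_mx11 mulrC => eD.
by apply: (lregX (n := k) dreg); rewrite /= eD mulrC !mxE.
Qed.

(* Replacing S by its characteristic matrix 'X + S makes the determinant regular;
   then evaluate at 0. *)
Lemma det_schur (K : comNzRingType) k (e : 'M[K]_1) (c : 'rV[K]_k)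
    (b : 'cV[K]_k) (S : 'M[K]_k) :
  \det (block_mx e c b S) = \det S * e 0 0 - (c *m \adj S *m b) 0 0.
Proof.
pose p2 m n (X : 'M[K]_(m, n)) : 'M[{poly K}]_(m, n) := map_mx polyC X.
pose T := char_poly_mx (- S).
have ev m n (X : 'M[K]_(m, n)) : map_mx (horner_eval 0) (p2 m n X) = X.
  by apply/matrixP => i j; rewrite !mxE /horner_eval hornerC.
have evT : map_mx (horner_eval 0) T = S.
  apply/matrixP => i j; rewrite !mxE /horner_eval.
  by rewrite hornerD hornerN hornerC hornerMn hornerX mul0rn add0r opprK.
have /(det_schur_lreg (p2 _ _ e) (p2 _ _ c) (p2 _ _ b)) : GRing.lreg (\det T).
  exact/monic_lreg/char_poly_monic.
move=> /(congr1 (horner_eval 0)).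
rewrite rmorphB rmorphM -!det_map_mx map_block_mx !ev evT => ->.
congr (_ * _ - _); first by rewrite -[in RHS](ev _ _ e) [in RHS]mxE.
rewrite -[in RHS](ev _ _ c) -[in RHS](ev _ _ b) -[in RHS]evT.
by rewrite -map_mx_adj -!map_mxM [RHS]mxE.
Qed.

(** * Gram determinants and scaled projections *)

Section Gram.
Variables (K : comNzRingType).

Definition gram m n (Y : 'M[K]_(m, n)) : K := \det (Y *m Y^T).

(* [gram Z] times the orthogonal projection onto the complement of the row space,
   in a form that makes sense for singular [Z Z^T]. *)
Definition gram_proj m n (Z : 'M[K]_(m, n)) : 'M[K]_n :=
  (gram Z)%:M - Z^T *m \adj (Z *m Z^T) *m Z.

Lemma gram_col_mx m n (x : 'rV[K]_n) (Z : 'M[K]_(m, n)) :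
  gram (col_mx x Z) = (x *m gram_proj Z *m x^T) 0 0.
Proof.
rewrite /gram tr_col_mx mul_col_row det_schur /gram_proj.
rewrite mulmxBr mulmxBl mul_mx_scalar -scalemxAl.
rewrite [RHS]mxE [X in _ = X + _]mxE [X in _ = _ + X]mxE.
by rewrite !mulmxA.
Qed.

Lemma gram_proj_tr m n (Z : 'M[K]_(m, n)) : (gram_proj Z)^T = gram_proj Z.
Proof.
rewrite /gram_proj linearB /= tr_scalar_mx !trmx_mul trmxK trmx_adj.
by rewrite trmx_mul trmxK mulmxA.
Qed.

(** Idempotence of the projection, scaled: [Z *m gram_proj Z] vanishes because [Z *m Z^T] times its
    adjugate is scalar. *)
Lemma gram_proj_sqr m n (Z : 'M[K]_(m, n)) :
  gram_proj Z *m gram_proj Z = gram Z *: gram_proj Z.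
Proof.
rewrite {1}/gram_proj mulmxBl mul_scalar_mx.
rewrite (_ : _ *m gram_proj Z = 0) ?subr0 // /gram_proj mulmxBr mul_mx_scalar.
rewrite -!mulmxA (mulmxA Z Z^T) (mulmxA (\adj _) (_ *m _)) mul_adj_mx.
by rewrite mul_scalar_mx scalemxAr subrr.
Qed.

Lemma gram_proj_trace m n (Z : 'M[K]_(m, n)) :
  \tr (gram_proj Z) = (n%:R - m%:R) * gram Z.
Proof.
rewrite /gram_proj linearB /= mxtrace_scalar -mulmxA mxtrace_mulC -mulmxA.
by rewrite mul_adj_mx mxtrace_scalar mulrBl !mulr_natl.
Qed.

End Gram.

Lemma quad_form_shift (K : comNzRingType) n (z e : 'rV[K]_n) N a : N^T = N ->
  ((z + a *: e) *m N *m (z + a *: e)^T) 0 0 =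
  (e *m N *m e^T) 0 0 * a ^+ 2 + 2 * (z *m N *m e^T) 0 0 * a
  + (z *m N *m z^T) 0 0.
Proof.
move=> NT.
have eze : (e *m N *m z^T) 0 0 = (z *m N *m e^T) 0 0.
  by rewrite -[in RHS](trmxK (z *m N)) -trmx_mul [RHS]mxE trmx_mul NT mulmxA.
rewrite linearD linearZ /= !(mulmxDl, mulmxDr) -!(scalemxAl, scalemxAr).
have mxD (X Y : 'M[K]_1) : (X + Y) 0 0 = X 0 0 + Y 0 0 by rewrite mxE.
have mxZ (X : 'M[K]_1) : (a *: X) 0 0 = a * X 0 0 by rewrite mxE.
by rewrite !(mxD, mxZ) eze; ring.
Qed.

(** * Row-by-row computation for Gaussian moments *)

Section Gaussian.
Variables (K : comNzRingType) (A : finType) (v w : A -> K).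
Hypothesis mw : moments7 v w 1 1 3 15.

Let w1 : \sum_a w a = 1. Proof. exact: moments7_sum mw. Qed.

(* Gaussian integration by parts, [E[x h(x)] = E[h'(x)]], for [h = (al x + be) q^p e]
   where [q' = 2 (al x + be)]. *)
Lemma wsum_gauss p al be ga e : (p < 3)%N ->
  wsum v w (fun a => a * (al * a + be) *
    (al * a ^+ 2 + 2 * be * a + ga) ^+ p * e) =
  wsum v w (fun a => (al * (al * a ^+ 2 + 2 * be * a + ga) ^+ p +
    (2 * p%:R) * ((al * a + be) ^+ 2 *
      (al * a ^+ 2 + 2 * be * a + ga) ^+ p.-1)) * e).
Proof.
case: p => [|[|[|//]]] _ /=.
- rewrite (wsum_poly (c0 := 0) (c1 := be * e) (c2 := al * e) (c3 := 0) (c4 := 0)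
    (c5 := 0) (c6 := 0) mw); last by move=> a; ring.
  rewrite (wsum_poly (c0 := al * e) (c1 := 0) (c2 := 0) (c3 := 0) (c4 := 0)
    (c5 := 0) (c6 := 0) mw); last by move=> a; ring.
  ring.
- rewrite (wsum_poly (c0 := 0) (c1 := be * ga * e)
    (c2 := (al * ga + 2 * be ^+ 2) * e)
    (c3 := 3 * al * be * e) (c4 := al ^+ 2 * e)
    (c5 := 0) (c6 := 0) mw); last by move=> a; ring.
  rewrite (wsum_poly (c0 := (al * ga + 2 * be ^+ 2) * e) (c1 := 6 * al * be * e)
    (c2 := 3 * al ^+ 2 * e) (c3 := 0) (c4 := 0)
    (c5 := 0) (c6 := 0) mw); last by move=> a; ring.
  ring.
- rewrite (wsum_poly (c0 := 0) (c1 := be * ga ^+ 2 * e)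
    (c2 := (al * ga ^+ 2 + 4 * be ^+ 2 * ga) * e)
    (c3 := (6 * al * be * ga + 4 * be ^+ 3) * e)
    (c4 := (2 * al ^+ 2 * ga + 8 * al * be ^+ 2) * e)
    (c5 := 5 * al ^+ 2 * be * e) (c6 := al ^+ 3 * e) mw); last by move=> a; ring.
  rewrite (wsum_poly (c0 := (al * ga ^+ 2 + 4 * be ^+ 2 * ga) * e)
    (c1 := 2 * (6 * al * be * ga + 4 * be ^+ 3) * e)
    (c2 := 3 * (2 * al ^+ 2 * ga + 8 * al * be ^+ 2) * e)
    (c3 := 20 * al ^+ 2 * be * e) (c4 := 5 * al ^+ 3 * e)
    (c5 := 0) (c6 := 0) mw); last by move=> a; ring.
  ring.
Qed.

Definition gram3 m n := avg v w (fun y : 'I_m * 'I_n -> K => gram (mat y) ^+ 3).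

Lemma dsubmx_set m n (y : 'I_(1 + m) * 'I_n -> K) i a :
  dsubmx (mat (set_coord y (lshift m 0, i) a)) = dsubmx (mat y).
Proof.
apply/matrixP => k l; rewrite !mxE /set_coord xpair_eqE.
by rewrite eq_rlshift.
Qed.

Lemma usubmx_set m n (y : 'I_(1 + m) * 'I_n -> K) i a :
  usubmx (mat (set_coord y (lshift m 0, i) a)) =
  usubmx (mat (set_coord y (lshift m 0, i) 0)) + a *: delta_mx 0 i.
Proof.
apply/matrixP => k l; rewrite !mxE /set_coord !xpair_eqE !ord1 !eqxx /=.
by case: eqP => _; rewrite ?mulr0 ?mulr1 ?addr0 ?add0r.
Qed.

Lemma gram_usub m n (Y : 'M[K]_(1 + m, n)) :
  gram Y = (usubmx Y *m gram_proj (dsubmx Y) *m (usubmx Y)^T) 0 0.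
Proof. by rewrite -gram_col_mx vsubmxK. Qed.

(** Write the Gram determinant as G = x N x^T with x the first row, and g for that of the other
    rows. Integrating by parts in every entry of x gives tr N = (n - m) g and 2p |xN|^2 G^(p-1),
    where |xN|^2 = g G since N^2 = g N. The bound on [p] keeps the degree in each entry at most
    6. *)
Lemma avg_gram_step m n p r : (p < 3)%N ->
  avg v w (fun y : 'I_(1 + m) * 'I_n -> K =>
    gram (mat y) ^+ p.+1 * gram (dsubmx (mat y)) ^+ r) =
  (n%:R - m%:R + 2 * p%:R) * avg v w (fun y : 'I_(1 + m) * 'I_n -> K =>
    gram (mat y) ^+ p * gram (dsubmx (mat y)) ^+ r.+1).
Proof.
move=> p3.
pose N (y : 'I_(1 + m) * 'I_n -> K) := gram_proj (dsubmx (mat y)).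
pose x (y : 'I_(1 + m) * 'I_n -> K) := usubmx (mat y).
transitivity (avg v w (fun y => \sum_(i < n) mat y (lshift m 0) i * (x y *m N y) 0 i *
    gram (mat y) ^+ p * gram (dsubmx (mat y)) ^+ r)).
  apply: eq_avg => y; rewrite -!mulr_suml exprS; congr (_ * _ * _).
  rewrite gram_usub mxE; apply: eq_bigr => i _; rewrite [in LHS]mulrC.
  by rewrite !mxE.
transitivity (avg v w (fun y => \sum_(i < n)
    (N y i i * gram (mat y) ^+ p + 2 * p%:R * ((x y *m N y) 0 i ^+ 2 *
    gram (mat y) ^+ p.-1)) * gram (dsubmx (mat y)) ^+ r)).
  rewrite !avg_sum; apply: eq_bigr => i _.
  apply: (eq_avg_set (i := (lshift m 0, i)) w1) => y.
  pose z := usubmx (mat (set_coord y (lshift m 0, i) 0)).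
  pose be := (z *m N y) 0 i.
  pose ga := (z *m N y *m z^T) 0 0.
  have eN a : N (set_coord y (lshift m 0, i) a) = N y.
    by rewrite /N dsubmx_set.
  have eu a : (x (set_coord y (lshift m 0, i) a) *m N y) 0 i = N y i i * a + be.
    rewrite /x usubmx_set mulmxDl mxE -scalemxAl -rowE addrC mulrC.
    by congr (_ + _); rewrite !mxE mulrC.
  have eg a : gram (mat (set_coord y (lshift m 0, i) a)) =
      N y i i * a ^+ 2 + 2 * be * a + ga.
    rewrite gram_usub dsubmx_set -/(N y) usubmx_set -/z.
    rewrite (quad_form_shift _ _ _ (gram_proj_tr _)) -/ga trmx_delta -!colE -rowE.
    by rewrite [col i (row i _) 0 0]mxE [row i _ 0 i]mxE [col i (z *m _) 0 0]mxE.
  under [in LHS]eq_fun => a do rewrite mat_set eN eu eg dsubmx_set.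
  under [in RHS]eq_fun => a do rewrite eN eu eg dsubmx_set.
  exact: wsum_gauss.
rewrite -avgZ; apply: eq_avg => y.
rewrite -mulr_suml exprS mulrA mulrA; congr (_ * _).
rewrite big_split /= -mulr_suml -mulr_sumr -mulr_suml.
rewrite -[\sum_i N y i i]/(\tr (N y)) gram_proj_trace.
have -> : \sum_(i < n) (x y *m N y) 0 i ^+ 2 = gram (dsubmx (mat y)) * gram (mat y).
  transitivity ((x y *m N y *m (x y *m N y)^T) 0 0).
    by rewrite [RHS]mxE; apply: eq_bigr => i _; rewrite expr2 [_^T i 0]mxE.
  rewrite trmx_mul gram_proj_tr mulmxA -(mulmxA (x y)) gram_proj_sqr.
  by rewrite -scalemxAr -scalemxAl mxE gram_usub.
by case: p p3 => [|p] _ /=; rewrite ?exprS; ring.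
Qed.

(** Three applications of [avg_gram_step], with p = 2, 1, 0, remove the first row. *)
Lemma gram3S m n : gram3 m.+1 n = (n%:R - m%:R) * (n%:R - m%:R + 2) *
  (n%:R - m%:R + 4) * gram3 m n.
Proof.
transitivity (avg v w (fun y : 'I_(1 + m) * 'I_n -> K =>
    gram (mat y) ^+ 3 * gram (dsubmx (mat y)) ^+ 0)).
  by apply: eq_avg => y; rewrite mulr1.
rewrite !avg_gram_step // mulrA mulrA; congr (_ * _); first ring.
have hI : injective (fun p : 'I_m * 'I_n => (rshift 1 p.1, p.2)).
  move=> [a b] [c d] e; congr (_, _); last exact: (congr1 snd e).
  exact: (rshift_inj (congr1 fst e)).
rewrite /gram3 -(avg_reindex v _ w1 hI); apply: eq_avg => y.
by rewrite mul1r; congr (gram _ ^+ 3); apply/matrixP => i j; rewrite !mxE.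
Qed.

Lemma gram3_0 n : gram3 0 n = 1.
Proof.
transitivity (avg v w (fun _ : 'I_0 * 'I_n -> K => 1)).
  by apply: eq_avg => y; rewrite /gram det_mx00 expr1n.
rewrite /avg -mulr_suml mulr1 -(bigA_distr_bigA (fun (_ : 'I_0 * 'I_n) => w)).
by rewrite big1.
Qed.

Lemma gram3E n k : gram3 k (n + k) = \prod_(n <= i < n + k)
  ((i.+1)%:R * (i.+3)%:R * (i.+4.+1)%:R).
Proof.
elim: k n => [|k IHk] n; first by rewrite gram3_0 addn0 big_geq.
(* The number of columns [n + k.+1] stays fixed while a row is removed, so the induction hypothesis
   is used at [n.+1]. *)
rewrite gram3S -addSnnS IHk addSn [RHS]big_ltn; last first.
  by rewrite ltnS leq_addr.
congr (_ * _); rewrite -addSn natrD addrK.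
by rewrite -!natrD !addnS !addn0.
Qed.

Lemma detm6_gauss n : detm6 v w n =
  \prod_(i < n) ((i.+1)%:R * (i.+3)%:R * (i.+4.+1)%:R).
Proof.
have := gram3E 0 n; rewrite add0n big_mkord => <-; apply: eq_avg => y.
by rewrite /gram det_mulmx det_tr -expr2 -exprM.
Qed.

End Gaussian.

(** * Deformation from the Gaussian moments *)

Lemma rmorph_detm6 (K L : comNzRingType) (th : {rmorphism K -> L}) (A : finType)
    (v w : A -> K) n :
  th (detm6 v w n) = detm6 (th \o v) (th \o w) n.
Proof.
rewrite rmorph_sum; apply: eq_bigr => x _; rewrite rmorphM rmorph_prod.
congr (_ * _); rewrite rmorphXn -det_map_mx; congr (\det _ ^+ 6).
by apply/matrixP => i j; rewrite !mxE.
Qed.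

Lemma deriv_prod (R : comNzRingType) (I : finType) (F : I -> {poly R}) :
  (\prod_i F i)^`() = \sum_i (F i)^`() * \prod_(j | j != i) F j.
Proof.
have gen (r : seq I) : uniq r -> (\prod_(i <- r) F i)^`() =
    \sum_(i <- r) (F i)^`() * \prod_(j <- r | j != i) F j.
  elim: r => [|i r IHr]; first by rewrite !big_nil derivC.
  case/andP=> ir ur; rewrite !big_cons derivM IHr // eqxx /=; congr (_ * _ + _).
    rewrite big_seq_cond [in RHS]big_seq_cond; apply: eq_bigl => j.
    by rewrite andbT; case jr: (j \in r) => //=; rewrite (memPn ir j jr).
  rewrite mulr_sumr big_seq [in RHS]big_seq; apply: eq_bigr => j jr.
  by rewrite big_cons eq_sym (memPn ir j jr) mulrCA.
by apply: gen; rewrite /index_enum -enumT enum_uniq.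
Qed.

Section Deformation.
Variables (R : numFieldType) (A : finType) (v w0 w1 : A -> R) (k4 k6 : R).
Hypothesis mw0 : moments7 v w0 1 1 3 15.
Hypothesis mw1 : moments7 v w1 0 0 k4 (15 * k4 + k6).

(* The variable 'X is the parameter of the path. *)
Let vX a : {poly R} := (v a)%:P.
Let wX a : {poly R} := (w0 a)%:P + (w1 a)%:P * 'X.

(** With unit variance and zero odd moments, the fourth and sixth moments are affine in the
    cumulants, so a straight segment of weights realizes the cumulants [k4 s] and [k6 s]. *)
Let mwX : moments7 vX wX 1 1 (3 + k4%:P * 'X) (15 + 15 * (k4%:P * 'X) + k6%:P * 'X).
Proof.
move=> k k6'; transitivity ((\sum_a w0 a * v a ^+ k)%:P
    + (\sum_a w1 a * v a ^+ k)%:P * 'X).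
  rewrite !rmorph_sum mulr_suml -big_split; apply: eq_bigr => a _ /=.
  by rewrite !polyCM !polyC_exp /vX /wX; ring.
rewrite mw0 // mw1 //; case: k k6' => [|[|[|[|[|[|[|//]]]]]]] _ /=;
  rewrite ?polyCD ?polyCM ?polyC1 ?polyC0 ?mul0r ?addr0 //.
by rewrite -!polyC_natr /=; ring.
Qed.

Let dm n := detm6 vX wX n.
Let c2 n := cof2 vX wX n.
Let c4 n := cof4 vX wX n.

Lemma path_detm6_expand n : n%:R * dm n = 5 * c2 n + 10 * (k4%:P * 'X) * c4 n +
  k6%:P * 'X * (n%:R ^+ 2 * dm n.-1).
Proof. exact: detm6_expand mwX n. Qed.

Lemma path_cof4_expand n : c4 n = n%:R ^+ 2 * (dm n.-1 + c2 n.-1).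
Proof. exact: cof4_expand mwX n. Qed.

(** The product rule on the weights resamples one entry from the tangent law [w1], which integrates
    a polynomial p of degree at most 6 to the mean of k4/24 p'''' + k6/720 p^(6). Here p is the
    sixth power of an affine function whose slope is the cofactor. *)
Lemma path_detm6_deriv n :
  (dm n)^`() = 15 * k4%:P * c4 n + k6%:P * (n%:R ^+ 2 * dm n.-1).
Proof.
have wX1 : \sum_a wX a = 1 := moments7_sum mwX.
pose w1P a := (w1 a)%:P : {poly R}.
have mw1P : moments7 vX w1P 0 0 k4%:P (15 * k4 + k6)%:P.
  move=> k k6'; transitivity ((\sum_a w1 a * v a ^+ k)%:P).
    rewrite rmorph_sum; apply: eq_bigr => a _.
    by rewrite /= polyCM polyC_exp.
  by rewrite mw1 //; case: k k6' => [|[|[|[|[|[|[|//]]]]]]] _ /=.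
transitivity (\sum_(p : 'I_n * 'I_n) avg vX wX (fun y =>
    wsum vX w1P (fun c => \det (mat (set_coord y p c)) ^+ 6))).
  rewrite /dm /detm6 /avg raddf_sum /=.
  under eq_bigr => x _.
    rewrite derivM deriv_prod.
    have -> : (\det (mat (fun i => vX (x i))) ^+ 6)^`() = 0.
      rewrite (_ : mat _ = map_mx polyC (mat (fun i => v (x i)))).
        by rewrite det_map_mx -polyC_exp derivC.
      by apply/matrixP => i j; rewrite !mxE.
    rewrite mulr0 addr0 mulr_suml.
    over.
  rewrite exchange_big; apply: eq_bigr => p _ /=.
  rewrite [RHS](avg_set_coord_gen vX w1P p (fun y => \det (mat y) ^+ 6) wX1).
  apply: eq_bigr => x _; congr (_ * _ * _).
  by rewrite /wX derivD derivC derivM derivC derivX mul0r !add0r mulr1.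
rewrite -(pair_bigA _ (fun i j => avg vX wX (fun y =>
    wsum vX w1P (fun c => \det (mat (set_coord y (i, j) c)) ^+ 6)))) /=.
have -> : k6%:P * (n%:R ^+ 2 * dm n.-1) =
    \sum_(i < n) \sum_(j < n) k6%:P * dm n.-1.
  by rewrite !sumr_const card_ord -mulrnA -[_ *+ (n * n)]mulr_natr natrM; ring.
rewrite /c4 /cof4 [15 * _ * _]mulr_sumr -big_split /=; apply: eq_bigr => i _.
rewrite [15 * _ * _]mulr_sumr -big_split /=; apply: eq_bigr => j _.
rewrite /dm -(avg_cof6 mwX i j) -!avgZ -avgD.
rewrite -[RHS](avg_set_coord vX (i, j) _ wX1); apply: eq_avg => y.
under [in LHS]eq_fun => a do rewrite det_set.
under [in RHS]eq_fun => a do rewrite cofactor_set_row det_set.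
set c := cofactor _ _ _; set r := _ - _.
rewrite (wsum_poly (c0 := r ^+ 6) (c1 := 6 * c * r ^+ 5)
  (c2 := 15 * c ^+ 2 * r ^+ 4)
  (c3 := 20 * c ^+ 3 * r ^+ 3) (c4 := 15 * c ^+ 4 * r ^+ 2)
  (c5 := 6 * c ^+ 5 * r) (c6 := c ^+ 6) mw1P); last by move=> a; ring.
rewrite (wsum_poly
  (c0 := 15 * k4%:P * c ^+ 4 * r ^+ 2 + k6%:P * c ^+ 6)
  (c1 := 30 * k4%:P * c ^+ 5 * r)
  (c2 := 15 * k4%:P * c ^+ 6) (c3 := 0) (c4 := 0)
  (c5 := 0) (c6 := 0) mwX); last by move=> a; ring.
rewrite polyCD polyCM -polyC_natr; ring.
Qed.

Lemma path_detm6_at0 n : (dm n).[0] = \prod_(i < n) (i.+1%:R * i.+3%:R * i.+4.+1%:R).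
Proof.
rewrite -(detm6_gauss mw0) -[LHS]/(horner_eval 0 _) rmorph_detm6.
congr (detm6 _ _ n); apply/funext => a; rewrite /= /horner_eval /vX /wX !hornerE //.
Qed.

Lemma path_detm6_at1 n : (dm n).[1] = detm6 v (fun a => w0 a + w1 a) n.
Proof.
rewrite -[LHS]/(horner_eval 1 _) rmorph_detm6.
congr (detm6 _ _ n); apply/funext => a; rewrite /= /horner_eval /vX /wX !hornerE //.
Qed.

End Deformation.

(** * Solution of the recursion *)

Section FpsDeriv.
Variable R : comNzRingType.
Implicit Types f g : fps R.

Lemma coef_fpsXn m n : ((fpsX : fps R) ^+ m) n = (n == m)%:R.
Proof.
elim: m n => [|m IHm] [|n]; rewrite ?expr0 ?exprS ?coef_fps1 //.
  by rewrite coef0_fpsM mul0r.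
rewrite coef_fpsM big_ord_recl mul0r add0r big_ord_recl /= mul1r.
by rewrite subSS subn0 IHm big1 ?addr0 // => i _; rewrite mul0r.
Qed.

Definition fps_deriv f : fps R := Fps (fun n => n.+1%:R * f n.+1).

Lemma coef_fps_deriv f n : fps_deriv f n = n.+1%:R * f n.+1.
Proof. by []. Qed.

Lemma fps_derivM f g : fps_deriv (f * g) = fps_deriv f * g + f * fps_deriv g.
Proof.
apply: fpsP => n; rewrite coef_fpsD !coef_fpsM /=.
transitivity (\sum_(i < n.+2) (i%:R * f i) * g (n.+1 - i)%N +
    \sum_(i < n.+2) f i * ((n.+1 - i)%:R * g (n.+1 - i)%N)).
  rewrite mulr_sumr -big_split; apply: eq_bigr => i _ /=.
  by rewrite -{1}(subnKC (leq_ord i)) natrD; ring.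
congr (_ + _).
  by rewrite big_ord_recl mul0r mul0r add0r; apply: eq_bigr => i _.
rewrite big_ord_recr /= subnn mul0r mulr0 addr0; apply: eq_bigr => i _.
by rewrite subSn // -ltnS.
Qed.

Lemma fps_derivX f m : fps_deriv (f ^+ m.+1) = m.+1%:R * (f ^+ m * fps_deriv f).
Proof.
elim: m => [|m IHm]; first by rewrite expr1 expr0 !mul1r.
by rewrite exprS fps_derivM IHm exprS -[m.+2]addn1 natrD; ring.
Qed.

End FpsDeriv.

Section ExpOverPower.
Variables (R : numFieldType) (k4 k6 : R).

Lemma coef_fps_expZX n : fps_exp (k6 *: (fpsX : fps R)) n = k6 ^+ n / n`!%:R.
Proof.
rewrite /fps_exp /fps_sum /= big_ord_recr /= big1 ?add0r => [|i _].
  by rewrite exprZn !coef_fpsZ coef_fpsXn eqxx mulr1 mulrC.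
by rewrite exprZn !coef_fpsZ coef_fpsXn gtn_eqF ?mulr0.
Qed.

Lemma deriv_fps_expZX : fps_deriv (fps_exp (k6 *: (fpsX : fps R))) =
  k6 *: fps_exp (k6 *: fpsX).
Proof.
apply: fpsP => n; rewrite coef_fpsZ coef_fps_deriv !coef_fps_expZX.
rewrite factS natrM exprS; field.
by rewrite nat1r !pnatr_eq0 -lt0n fact_gt0.
Qed.

Let Q : fps R := 1 - k4 *: fpsX.

Lemma fps_linear_unit : Q \is a GRing.unit.
Proof. by rewrite fps_unitE coef_fpsB coef_fpsZ /= mulr0 subr0 unitr1. Qed.

Definition exp_over_power m : fps R := fps_exp (k6 *: fpsX) / Q ^+ m.

Let P := exp_over_power.

(** Differentiate [P m.+1 * Q ^+ m.+1 = fps_exp (k6 *: fpsX)] and cancel [Q ^+ m]. *)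
Let deriv_P m : fps_deriv (P m.+1) * Q = (m.+1%:R * k4) *: P m.+1 + k6 *: (P m.+1 * Q).
Proof.
have dQ : fps_deriv Q = - k4%:A.
  apply: fpsP => n; rewrite coef_fps_deriv coef_fpsB coef_fpsZ coef_fpsN coef_fpsZ.
  rewrite !coef_fps1 /= sub0r; case: n => [|n] /=.
    by rewrite !mulr1 mul1r.
  by rewrite !mulr0 oppr0 mulr0.
have PQ : P m.+1 * Q ^+ m.+1 = fps_exp (k6 *: fpsX).
  by rewrite divrK // unitrX // fps_linear_unit.
have := congr1 (@fps_deriv R) PQ; rewrite fps_derivM fps_derivX deriv_fps_expZX.
have aux (S : comNzRingType) (d p q a b : S) :
    d * q ^+ m.+1 + p * (m.+1%:R * (q ^+ m * - a)) = b * (p * q ^+ m.+1) ->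
    q ^+ m * (d * q) = q ^+ m * (m.+1%:R * a * p + b * (p * q)).
  rewrite exprS => /eqP; rewrite -subr_eq0 => /eqP e.
  by apply/eqP; rewrite -subr_eq0 -[X in _ == X]e; apply/eqP; ring.
rewrite -PQ dQ -[k6 *: _]mulr_algl => /aux eD.
apply: (mulrI (unitrX m fps_linear_unit)).
rewrite eD [k6%:A * _]mulr_algl; congr (_ * (_ + _)).
by rewrite -mulrA mulr_natl mulr_algl -scalerA scaler_nat.
Qed.

Lemma coef_exp_over_power m : (0 < m)%N ->
  [/\ P m 0 = 1, P m 1 = k6 + m%:R * k4 &
    forall l, l.+2%:R * P m l.+2 =
      (k4 * l.+1%:R + k6 + m%:R * k4) * P m l.+1 - k4 * k6 * P m l].
Proof.
case: m => // m _.
have P0 : P m.+1 0 = 1.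
  have Q0 : (Q ^+ m.+1) 0 = 1.
    elim: m.+1 => [|k IHk]; first by rewrite expr0.
    by rewrite exprS coef0_fpsM IHk mulr1 coef_fpsB coef_fpsZ mulr0 subr0.
  have : (P m.+1 * Q ^+ m.+1) 0 = fps_exp (k6 *: fpsX) 0.
    by rewrite divrK // unitrX // fps_linear_unit.
  by rewrite coef0_fpsM Q0 mulr1 coef_fps_expZX expr0 divr1.
have MQ0 (f : fps R) : (f * Q) 0 = f 0.
  by rewrite coef0_fpsM coef_fpsB coef_fpsZ /= mulr0 subr0 mulr1.
have MQ (f : fps R) n : (f * Q) n.+1 = f n.+1 - k4 * f n.
  rewrite mulrC coef_fpsM big_ord_recl big_ord_recl big1 => [|i _].
    rewrite addr0 subn0 subn1 !coef_fpsB !coef_fpsZ !coef_fps1 /=.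
    by rewrite !mulr0 !mulr1; ring.
  by rewrite coef_fpsB coef_fpsZ coef_fps1 /= mulr0 subr0 mul0r.
have D n := congr1 (fun f : fps R => f n) (deriv_P m).
split=> // [|l].
  have := D 0; rewrite coef_fpsD !coef_fpsZ !MQ0 coef_fps_deriv P0 !mulr1 mul1r => ->.
  by rewrite addrC.
have := D l.+1; rewrite coef_fpsD !coef_fpsZ !MQ !coef_fps_deriv => eD.
apply/eqP; rewrite -subr_eq0; apply/eqP.
move/eqP: eD; rewrite -subr_eq0 => /eqP <-; ring.
Qed.

End ExpOverPower.

Section Recursion.
(** [D n l], [C2 n l] and [C4 n l] stand for the coefficients of s^l in f(n), A(n) and B(n) along
    the path. *)
Variables (R : numFieldType) (k4 k6 : R) (D C2 C4 : nat -> nat -> R).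
Hypothesis D_deriv : forall n l, l.+1%:R * D n l.+1 =
  15 * k4 * C4 n l + k6 * (n%:R ^+ 2 * D n.-1 l).
Hypothesis C4_expand : forall n l, C4 n l = n%:R ^+ 2 * (D n.-1 l + C2 n.-1 l).
Hypothesis D_expand0 : forall n, n%:R * D n 0 = 5 * C2 n 0.
Hypothesis D_expand : forall n l, n%:R * D n l.+1 =
  5 * C2 n l.+1 + 10 * k4 * C4 n l + k6 * (n%:R ^+ 2 * D n.-1 l).

(** Each power of s lowers the size of the matrix by one; the induction carries [C2] along with
    [D]. *)
Lemma path_coef_vanish n l : (n < l)%N -> D n l = 0.
Proof.
suff : forall l, (n < l)%N -> D n l = 0 /\ C2 n l = 0 by move=> H /H[].
elim: n => [|n IHn] [|k] // kn.
  have C40 : C4 0 k = 0 by rewrite C4_expand expr0n mul0r.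
  have D0 : D 0 k.+1 = 0.
    apply: (mulfI (x := k.+1%:R)); first by rewrite pnatr_eq0.
    by rewrite D_deriv C40 expr0n mul0r !mulr0 addr0.
  split=> //; apply: (mulfI (x := 5%:R)); first by rewrite pnatr_eq0.
  have := D_expand 0 k; rewrite mul0r C40 expr0n mul0r !mulr0 !addr0 => <-.
  by [].
have [D0 C20] := IHn k kn.
have C40 : C4 n.+1 k = 0 by rewrite C4_expand /= D0 C20 addr0 mulr0.
have D0' : D n.+1 k.+1 = 0.
  apply: (mulfI (x := k.+1%:R)); first by rewrite pnatr_eq0.
  by rewrite D_deriv C40 /= D0 !mulr0 addr0.
split=> //; apply: (mulfI (x := 5%:R)); first by rewrite pnatr_eq0.
by have := D_expand n.+1 k; rewrite /= D0' C40 D0 !mulr0 !addr0 => <-.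
Qed.

Lemma path_coef_rec0 i : D i.+1 1 = (i.+1%:R ^+ 2) * (k6 + (15 + 3 * i)%:R * k4) * D i 0.
Proof.
have := D_deriv i.+1 0; rewrite mul1r => ->; rewrite C4_expand /=.
have -> : 15 * k4 * (i.+1%:R ^+ 2 * (D i 0 + C2 i 0)) =
  i.+1%:R ^+ 2 * (15 * k4 * D i 0 + 3 * k4 * (5 * C2 i 0)) by ring.
by rewrite -D_expand0 natrD natrM; ring.
Qed.

(** [D_deriv] and [D_expand] at [n.+1] express [C4 n.+1 l] and [C2 n.+1 l.+1] through [D], so both
    can be eliminated. *)
Lemma path_coef_rec n l : l.+2%:R * D n.+2 l.+2 =
  n.+2%:R ^+ 2 * ((15 * k4 + k6 + 3 * k4 * n.+1%:R - 2 * k4 * l.+1%:R) * D n.+1 l.+1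
   - k4 * k6 * (n.+1%:R ^+ 2 * D n l)).
Proof.
rewrite D_deriv C4_expand /=.
have := D_expand n.+1 l; have := D_deriv n.+1 l => /= e1 e2.
have e3 : 15 * k4 * C4 n.+1 l = l.+1%:R * D n.+1 l.+1 - k6 * (n.+1%:R ^+ 2 * D n l).
  by rewrite e1; ring.
have e4 : 15 * k4 * C2 n.+1 l.+1 = 3 * k4 * (n.+1%:R * D n.+1 l.+1) -
    2 * k4 * (15 * k4 * C4 n.+1 l) - 3 * k4 * k6 * (n.+1%:R ^+ 2 * D n l).
  by rewrite e2; ring.
have -> : 15 * k4 * (n.+2%:R ^+ 2 * (D n.+1 l.+1 + C2 n.+1 l.+1)) =
  n.+2%:R ^+ 2 * (15 * k4 * D n.+1 l.+1 + 15 * k4 * C2 n.+1 l.+1) by ring.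
rewrite e4 e3; ring.
Qed.

(** On the diagonal n = i + l the factor of [path_coef_rec] becomes k4 (l + 1) + k6 + (15 + 3i) k4.
    After division by the squared factorial this is the three-term recurrence of
    [exp_over_power k4 k6 (15 + 3 * i)]. *)
Lemma path_coef_solve i l : D (i + l) l / (i + l)`!%:R ^+ 2 =
  D i 0 / i`!%:R ^+ 2 * exp_over_power k4 k6 (15 + 3 * i) l.
Proof.
have f0 n : n`!%:R != 0 :> R by rewrite pnatr_eq0 -lt0n fact_gt0.
have n0 n : n.+1%:R != 0 :> R by rewrite pnatr_eq0.
have [|P0 P1 PS] := @coef_exp_over_power R k4 k6 (15 + 3 * i) => //.
suff [] : (D (i + l) l / (i + l)`!%:R ^+ 2 =
  D i 0 / i`!%:R ^+ 2 * exp_over_power k4 k6 (15 + 3 * i) l) /\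
  (D (i + l.+1) l.+1 / (i + l.+1)`!%:R ^+ 2 =
  D i 0 / i`!%:R ^+ 2 * exp_over_power k4 k6 (15 + 3 * i) l.+1) by [].
elim: l => [|l [IH1 IH2]].
  rewrite addn0 P0 mulr1 addn1 path_coef_rec0 P1 factS natrM; split=> //.
  by field; rewrite nat1r f0 n0.
split=> //; apply: (mulfI (n0 l.+1)); rewrite [RHS]mulrCA PS mulrBr.
rewrite [X in X - _]mulrCA -IH2 [X in _ - X]mulrCA -IH1 !addnS mulrA path_coef_rec !factS !natrM.
have -> : (15 + 3 * i)%:R = 15 + 3 * i%:R :> R by rewrite natrD natrM.
have e k : k.+1%:R = k%:R + 1 :> R by rewrite -addn1 natrD.
have := n0 (i + l)%N; have := n0 (i + l).+1; have := f0 (i + l)%N.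
rewrite !e natrD => a b c; field.
by rewrite ?a ?b ?c.
Qed.

End Recursion.

(** * Closed form of the sixth determinant moment at the end of the path *)

Section Deformed.
Variables (R : numFieldType) (A : finType) (v w0 w1 : A -> R) (k4 k6 : R).
Hypothesis mw0 : moments7 v w0 1 1 3 15.
Hypothesis mw1 : moments7 v w1 0 0 k4 (15 * k4 + k6).

(** The product is i! (i+2)!/2 (i+4)!/24, whence the 48. *)
Lemma gauss_coef i : (\prod_(j < i) (j.+1%:R * j.+3%:R * j.+4.+1%:R)) / i`!%:R ^+ 2
  = ((1 + i) * (2 + i) * (4 + i)`!)%:R / 48 :> R.
Proof.
have f0 n : n`!%:R != 0 :> R by rewrite pnatr_eq0 -lt0n fact_gt0.
have n0 n : n.+1%:R != 0 :> R by rewrite pnatr_eq0.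
elim: i => [|i IHi].
  rewrite big_ord0 expr1n divr1 divff // pnatr_eq0 //.
rewrite big_ord_recr /= factS.
transitivity (\prod_(j < i) (j.+1%:R * j.+3%:R * j.+4.+1%:R) / i`!%:R ^+ 2 *
   (i.+3%:R * i.+4.+1%:R / i.+1%:R) : R).
  by rewrite natrM; field; rewrite nat1r f0 n0.
rewrite IHi !add1n !add2n !addnS !addSn !add0n (factS i.+4) !natrM.
field.
by rewrite nat1r n0.
Qed.

Lemma detm6_solve n : detm6 v (fun a => w0 a + w1 a) n / n`!%:R ^+ 2 =
  \sum_(i < n.+1) ((1 + i) * (2 + i) * (4 + i)`!)%:R / 48 *
     exp_over_power k4 k6 (15 + 3 * i) (n - i)%N.
Proof.
rewrite -path_detm6_at1.
pose vX a : {poly R} := (v a)%:P.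
pose wX a : {poly R} := (w0 a)%:P + (w1 a)%:P * 'X.
pose D n l := (detm6 vX wX n)`_l.
pose C2 n l := (cof2 vX wX n)`_l.
pose C4 n l := (cof4 vX wX n)`_l.
have nC (k : nat) : k%:R = k%:R%:P :> {poly R} by rewrite polyC_natr.
have D_deriv m l : l.+1%:R * D m l.+1 =
    15 * k4 * C4 m l + k6 * (m%:R ^+ 2 * D m.-1 l).
  have := congr1 (fun p : {poly R} => p`_l) (path_detm6_deriv mw0 mw1 m).
  rewrite coef_deriv -[_ *+ l.+1]mulr_natl => ->.
  by rewrite !nC -polyC_exp -polyCM coefD !coefCM.
have C4_expand m l : C4 m l = m%:R ^+ 2 * (D m.-1 l + C2 m.-1 l).
  by rewrite /C4 (path_cof4_expand mw0 mw1 m) nC -polyC_exp coefCM coefD.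
have D_expand0 m : m%:R * D m 0 = 5 * C2 m 0.
  have := congr1 (fun p : {poly R} => p`_0) (path_detm6_expand mw0 mw1 m).
  rewrite !nC -polyC_exp -!mulrA !coefD !coefCM !coefXM /= => ->.
  by rewrite !mulr0 !addr0.
have D_expand m l : m%:R * D m l.+1 =
    5 * C2 m l.+1 + 10 * k4 * C4 m l + k6 * (m%:R ^+ 2 * D m.-1 l).
  have := congr1 (fun p : {poly R} => p`_l.+1) (path_detm6_expand mw0 mw1 m).
  rewrite !nC -polyC_exp -!mulrA !coefD !coefCM !coefXM /= => ->.
  by rewrite coefCM !mulrA.
(* The value at s = 1 is the sum of the coefficients, of degree at most n. Reversing the sum puts
   the coefficient of s^(n-i) on diagonal [i]. *)
rewrite (horner_coef_wide (n := n.+1)); last first.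
  apply/leq_sizeP => l nl.
  exact: (path_coef_vanish D_deriv C4_expand D_expand).
rewrite (reindex_inj rev_ord_inj) mulr_suml; apply: eq_bigr => i _.
have -> : nat_of_ord (rev_ord i) = (n - i)%N by rewrite /= subSS.
have := path_coef_solve D_deriv C4_expand D_expand0 D_expand i (n - i).
rewrite subnKC ?leq_ord // expr1n mulr1 => ->.
by rewrite -gauss_coef /D -horner_coef0 (path_detm6_at0 w1 mw0).
Qed.

End Deformed.

(** * Products of independent random variables *)

Section Independence.
Context d d' (T : measurableType d) (T' : measurableType d') (R : realType)
  (P : probability T R).

Import HBNNSimple.

(** Monotone convergence along simple functions: the weighted integral of [g] is determined by those
    of indicators. *)
Lemma ge0_integral_comp_approx (X : {RV P >-> T'}) (W : T -> R) (g : T' -> R)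
    (mg : measurable_fun [set: T'] (EFin \o g)) :
    measurable_fun [set: T] W -> (forall t, 0 <= W t) -> (forall x, 0 <= g x) ->
  let h := nnsfun_approx measurableT mg in
  (\int[P]_t (W t * g (X t))%:E = limn (fun n => \sum_(y \in range (h n))
    (y%:E * \int[P]_t (W t * \1_(h n @^-1` [set y]) (X t))%:E)))%E.
Proof.
move=> mW W0 g0 h.
have mX : measurable_fun [set: T] X by [].
have -> : (\int[P]_t (W t * g (X t))%:E =
    limn (fun n => \int[P]_t (W t * h n (X t))%:E))%E.
  rewrite -monotone_convergence //.
  - apply: eq_integral => t _; apply/esym/cvg_lim => //.
    under eq_fun do rewrite EFinM.
    rewrite EFinM; apply: cvgeZl => //.
    by apply: (cvg_nnsfun_approx measurableT mg) => // x _; rewrite lee_fin.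
  - move=> n; apply/measurable_EFinP/measurable_funM => //.
    exact: measurableT_comp.
  - by move=> n t _; rewrite lee_fin mulr_ge0.
  - move=> t _ a b ab; rewrite lee_fin ler_wpM2l //.
    exact/lefP/nd_nnsfun_approx.
congr (limn _); apply/funext => n.
transitivity (\int[P]_t (\sum_(y \in range (h n))
    (W t * (y * \1_(h n @^-1` [set y]) (X t)))%:E))%E.
  apply: eq_integral => t _.
  by rewrite {1}fimfunE mulr_fsumr // fsumEFin.
have mI y : measurable_fun [set: T]
    (fun t => \1_(h n @^-1` [set y]) (X t) : R).
  exact: measurableT_comp.
rewrite ge0_integral_fsum //; last 2 first.
  - move=> y; apply/measurable_EFinP/measurable_funM => //.
    exact: measurable_funM.
  - move=> y t _; rewrite lee_fin mulr_ge0 // -lee_fin.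
    exact: nnfun_muleindic_ge0.
apply: eq_fsbigr => y; rewrite inE => -[x _ <-].
rewrite -ge0_integralZl_EFin //.
- by apply: eq_integral => t _; rewrite -EFinM mulrCA.
- by move=> t _; rewrite lee_fin mulr_ge0.
- exact/measurable_EFinP/measurable_funM.
Qed.

Lemma ge0_integral_comp_eq (X : {RV P >-> T'}) (W1 W2 : T -> R) (g : T' -> R) :
    measurable_fun [set: T] W1 -> (forall t, 0 <= W1 t) ->
    measurable_fun [set: T] W2 -> (forall t, 0 <= W2 t) ->
    (forall B, measurable B -> (\int[P]_t (W1 t * \1_B (X t))%:E =
       \int[P]_t (W2 t * \1_B (X t))%:E)%E) ->
    measurable_fun [set: T'] g -> (forall x, 0 <= g x) ->
  (\int[P]_t (W1 t * g (X t))%:E = \int[P]_t (W2 t * g (X t))%:E)%E.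
Proof.
move=> mW1 W10 mW2 W20 WE /measurable_EFinP mg g0.
rewrite (ge0_integral_comp_approx X mg) // (ge0_integral_comp_approx X mg) //.
congr (limn _); apply/funext => n; apply: eq_fsbigr => y _.
by rewrite WE.
Qed.

End Independence.

Section IndepFamily.
Context d (T : measurableType d) (R : realType) (P : probability T R).
Variables (I : finType) (X : I -> {RV P >-> R}).
Hypothesis X_indep : mutually_independent X.

Let mean (f : R -> R) i : R := fine (\int[P]_t (f (X i t))%:E)%E.

Let measurable_comp (f : R -> R) i : measurable_fun [set: R] f ->
  measurable_fun [set: T] (fun t => f (X i t)).
Proof. by move=> mf; apply: (measurableT_comp mf). Qed.

Let integrable_fineK (f : R -> R) i :
  P.-integrable [set: T] (fun t => (f (X i t))%:E) ->
  (\int[P]_t (f (X i t))%:E = (mean f i)%:E)%E.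
Proof. by move=> fI; rewrite /mean fineK // integrable_fin_num. Qed.

Let integrable_indic_comp (B : set R) i : measurable B ->
  P.-integrable [set: T] (fun t => (\1_B (X i t))%:E).
Proof.
move=> mB; have -> : (fun t => (\1_B (X i t) : R)%:E) =
    (fun t => (\1_(X i @^-1` B) t)%:E) by apply/funext.
apply: integrable_indic; rewrite -[_ @^-1` _]setTI; exact: measurable_funPT.
Qed.

(* The induction generalizes one coordinate at a time from an indicator function to
   an arbitrary nonnegative function; [s] lists the coordinates already treated. *)
Lemma ge0_integral_prod_indep (s : seq I) (phi : I -> R -> R) :
    (forall i, measurable_fun [set: R] (phi i)) -> (forall i x, 0 <= phi i x) ->
    (forall i, P.-integrable [set: T] (fun t => (phi i (X i t))%:E)) ->
    (forall i, i \notin s -> exists2 B, measurable B & phi i = \1_B) ->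
  (\int[P]_t (\prod_i phi i (X i t))%:E = (\prod_i mean (phi i) i)%:E)%E.
Proof.
elim: s phi => [|k s IHs] phi mphi phi0 phiI phiB.
  have [B mB] : exists2 B, (forall i, measurable (B i)) &
      (forall i, phi i = \1_(B i)).
    have /choice[B HB] : forall i, exists B, measurable B /\ phi i = \1_B.
      by move=> i; have [B mB ->] := phiB i isT; exists B.
    by exists B => i; case: (HB i).
  move=> phiE.
  have mXB i : measurable (X i @^-1` B i).
    by rewrite -[_ @^-1` _]setTI; exact: measurable_funPT.
  transitivity (\int[P]_t (\1_(\bigcap_(i in [set` [set: I]%SET]) (X i @^-1` B i)) t)%:E)%E.
    apply: eq_integral => t _; congr (_%:E); rewrite indicE.
    case: (boolP (t \in _)) => [|tB].
      rewrite inE => tB; rewrite big1 // => i _; rewrite phiE indicE mem_set //.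
      by apply: tB; rewrite /= finset.in_setT.
    have [i nXi] : exists i, ~ B i (X i t).
      apply: contrapT => nB; move: tB; rewrite notin_setE; apply => i _ /=.
      by apply: contrapT => nBi; apply: nB; exists i.
    by rewrite (bigD1 i) //= phiE indicE memNset // mul0r.
  rewrite integral_indic ?setIT //; last first.
    by apply: fin_bigcap_measurable => //; exact: finite_finset.
  rewrite [LHS](X_indep [set: I]%SET mB) -prodEFin.
  apply: eq_big => [i|i _]; first by rewrite finset.in_setT.
  rewrite -integrable_fineK // phiE.
  have -> : (\int[P]_t (\1_(B i) (X i t))%:E =
    \int[P]_t (\1_(X i @^-1` B i) t)%:E)%E by [].
  by rewrite integral_indic // setIT.
pose W1 t := \prod_(i | i != k) phi i (X i t).
pose c := \prod_(i | i != k) mean (phi i) i.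
have c0 : 0 <= c.
  apply: prodr_ge0 => i _; apply: fine_ge0; apply: integral_ge0 => t _.
  by rewrite lee_fin.
transitivity (\int[P]_t (W1 t * phi k (X k t))%:E)%E.
  by apply: eq_integral => t _; rewrite (bigD1 k) //= mulrC.
(* The other factors [W1] may be replaced by the constant [c] once both weights agree on indicators
   of [X k]; that agreement is the induction hypothesis with [\1_B] at place [k]. *)
rewrite (@ge0_integral_comp_eq _ _ _ _ _ _ (X k) W1 (cst c)) //.
- under eq_integral do rewrite EFinM.
  rewrite ge0_integralZl_EFin //; last 2 first.
  + by move=> t _; rewrite lee_fin.
  + by apply/measurable_EFinP; exact: measurable_comp.
  by rewrite integrable_fineK // -EFinM [in RHS](bigD1 k) //= mulrC.
- have -> : W1 = (fun t => \prod_i if i != k then phi i (X i t) else 1).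
    by apply/funext => t; rewrite /W1 big_mkcond.
  apply: measurable_prod => i _; case: (i != k) => //.
  exact: (measurable_comp i (mphi i)).
- by move=> t; apply: prodr_ge0.
move=> B mB.
pose psi i := if i == k then \1_B else phi i.
transitivity (\int[P]_t (\prod_i psi i (X i t))%:E)%E.
  apply: eq_integral => t _; rewrite [in RHS](bigD1 k) //= mulrC /psi eqxx.
  by congr ((_ * _)%:E); apply: eq_bigr => i /negPf ->.
rewrite IHs.
- under [RHS]eq_integral do rewrite EFinM.
  rewrite ge0_integralZl_EFin //; last first.
  + by apply/measurable_EFinP; exact: measurable_comp.
  rewrite integrable_fineK; last exact: integrable_indic_comp.
  rewrite -EFinM (bigD1 k) //= mulrC /psi eqxx; congr ((_ * _)%:E).
  by apply: eq_bigr => i /negPf ->.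
- by move=> i; rewrite /psi; case: ifP.
- by move=> i x; rewrite /psi; case: ifP.
- move=> i; rewrite /psi; case: eqP => [->|_]; last exact: phiI.
  exact: integrable_indic_comp.
- move=> i si; rewrite /psi; case: eqP => [_|/eqP ik]; first by exists B.
  by apply: phiB; rewrite inE negb_or ik.
Qed.

Lemma integral_prod_indep (g : I -> R -> R) :
    (forall i, measurable_fun [set: R] (g i)) ->
    (forall i, P.-integrable [set: T] (fun t => (g i (X i t))%:E)) ->
  P.-integrable [set: T] (fun t => (\prod_i g i (X i t))%:E) /\
  (\int[P]_t (\prod_i g i (X i t))%:E = (\prod_i mean (g i) i)%:E)%E.
Proof.
move=> mg gI.
(* Expanding the product of [g^+ - g^-] reduces to nonnegative factors. *)
pose pn (b : bool) i : R -> R := if b then (g i)^\+ else (g i)^\-.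
have gB i x : pn true i x - pn false i x = g i x.
  exact: (congr1 (fun f => f x) (funrposBneg (g i))).
have mpn b i : measurable_fun [set: R] (pn b i).
  by rewrite /pn; case: b; [exact: measurable_funrpos|exact: measurable_funrneg].
have pn0 b i x : 0 <= pn b i x.
  by rewrite /pn; case: b; [exact: funrpos_ge0|exact: funrneg_ge0].
have pnI b i : P.-integrable [set: T] (fun t => (pn b i (X i t))%:E).
  rewrite /pn; case: b.
    exact: (integrable_funrpos measurableT (gI i)).
  exact: (integrable_funrneg measurableT (gI i)).
have prodE (b : {ffun I -> bool}) :
    (\int[P]_t (\prod_i pn (b i) i (X i t))%:E =
     (\prod_i mean (pn (b i) i) i)%:E)%E.
  apply: (@ge0_integral_prod_indep (enum I) (fun i => pn (b i) i)) => // i.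
  by rewrite mem_enum.
have prodI (b : {ffun I -> bool}) :
    P.-integrable [set: T] (fun t => (\prod_i pn (b i) i (X i t))%:E).
  apply/integrableP; split.
    apply/measurable_EFinP; apply: measurable_prod => i _.
    exact: measurable_comp.
  under eq_integral => t _.
    rewrite gee0_abs; last by rewrite lee_fin; exact: prodr_ge0.
    over.
  by rewrite prodE ltry.
have gE t : (\prod_i g i (X i t))%:E = (\sum_(b : {ffun I -> bool})
    ((\prod_i (-1) ^+ (~~ b i))%R%:E * (\prod_i pn (b i) i (X i t))%R%:E))%E.
  under [RHS]eq_bigr do rewrite -EFinM -big_split.
  rewrite sumEFin; congr (_%:E).
  rewrite -(bigA_distr_bigA (fun i b => (-1) ^+ (~~ b) * pn b i (X i t))) /=.
  apply: eq_bigr => i _; rewrite big_bool /= expr0 expr1 mul1r mulN1r.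
  by rewrite gB.
have sgI (b : {ffun I -> bool}) : P.-integrable [set: T]
    (fun t => (\prod_i (-1) ^+ (~~ b i))%:E * (\prod_i pn (b i) i (X i t))%:E)%E.
  exact: integrableZl.
split.
  have -> : (fun t => (\prod_i g i (X i t))%:E) = _ := funext gE.
  exact: integrable_sum.
under eq_integral do rewrite gE.
rewrite integral_sum //.
under [LHS]eq_bigr do rewrite integralZl // prodE -EFinM -big_split.
rewrite sumEFin; congr (_%:E).
rewrite -(bigA_distr_bigA (fun i b => (-1) ^+ (~~ b) * mean (pn b i) i)) /=.
apply: eq_bigr => i _; rewrite big_bool /= expr0 expr1 mul1r mulN1r.
apply: EFin_inj; rewrite EFinB -(integrable_fineK (gI i)).
rewrite -(integrable_fineK (pnI true i)) -(integrable_fineK (pnI false i)).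
rewrite -integralB_EFin //; [|exact: (pnI true i)|exact: (pnI false i)].
  by apply: eq_integral => t _; rewrite -EFinB gB.
Qed.

End IndepFamily.

(** * Reduction to moments *)

(** The nodes 0, ..., N-1 are distinct in characteristic 0, so their Vandermonde matrix is
    invertible. *)
Lemma moment_weights (R : numFieldType) N (m : nat -> R) :
  exists w : 'I_N -> R, forall k, (k < N)%N ->
    \sum_a w a * (a%:R : R) ^+ k = m k.
Proof.
pose V := Vandermonde N (\row_(j < N) j%:R : 'rV[R]_N).
have Vu : V \in unitmx.
  rewrite unitmxE det_Vandermonde unitfE; apply/prodf_neq0 => i _.
  apply/prodf_neq0 => j ij; rewrite !mxE subr_eq0 eqr_nat.
  by rewrite gtn_eqF.
pose w := invmx V *m \col_k m k.
exists (fun a => w a 0) => k kN.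
have := congr1 (fun X : 'cV_N => X (Ordinal kN) 0) (mulKVmx Vu (\col_k m k)).
rewrite -/w [RHS]mxE /= => <-; rewrite mxE; apply: eq_bigr => a _.
by rewrite !mxE mulrC.
Qed.

Definition perm_count q n (f : {ffun 'I_q -> 'S_n}) (p : 'I_n * 'I_n) : nat :=
  (\sum_(k < q) (f k p.1 == p.2))%N.

Lemma perm_count_le q n (f : {ffun 'I_q -> 'S_n}) p : (perm_count f p <= q)%N.
Proof.
rewrite -[leqRHS](card_ord q) -sum1_card /perm_count.
by apply: leq_sum => k _; case: (_ == _).
Qed.

Lemma sum_perm_count q n (f : {ffun 'I_q -> 'S_n}) i :
  (\sum_j perm_count f (i, j) = q)%N.
Proof.
rewrite exchange_big -[RHS](card_ord q) -sum1_card; apply: eq_bigr => k _ /=.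
rewrite (bigD1 (f k i)) //= eqxx big1 // => j.
by rewrite eq_sym => /negPf ->.
Qed.

(* Six entries in a row with five of them equal leave an isolated one, so the
   fifth moment never contributes when the first one vanishes. *)
Lemma perm_count5 n (f : {ffun 'I_6 -> 'S_n}) p :
  perm_count f p = 5%N -> exists p', perm_count f p' = 1%N.
Proof.
case: p => i j cij; have := sum_perm_count f i.
rewrite (bigD1 j) //= cij => /eqP; rewrite (eqn_add2l 5 _ 1) => sum1.
have [j' /andP[j'j j'0]] : exists j', (j' != j) && (perm_count f (i, j') != 0%N).
  apply/existsP; apply: contraTT sum1 => /existsPn H.
  rewrite big1 // => j' j'j; have := H j'.
  by rewrite j'j /= negbK => /eqP.
exists (i, j'); move: sum1; rewrite (bigD1 j') //=.
by case: (perm_count f (i, j')) j'0 => [|[|c]].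
Qed.

(** If an exponent 5 occurs, so does an exponent 1, and both products vanish; otherwise they agree
    factor by factor. *)
Lemma eq_prod_moments (K : comNzRingType) n (f : {ffun 'I_6 -> 'S_n})
    (m m' : nat -> K) :
    m 1%N = 0 -> (forall k, (k <= 6)%N -> k != 5%N -> m k = m' k) ->
  \prod_p m (perm_count f p) = \prod_p m' (perm_count f p).
Proof.
move=> m1 mE; case: (pickP (fun p => perm_count f p == 5%N)) => [p /eqP f5|f5].
  have [p' f1] := perm_count5 f5.
  by rewrite (bigD1 p') //= [RHS](bigD1 p') //= f1 -mE // m1 !mul0r.
by apply: eq_bigr => p _; rewrite mE ?perm_count_le // f5.
Qed.

Lemma det_exp_expand (K : comNzRingType) q n (X : 'M[K]_n) : \det X ^+ q =
  \sum_(f : {ffun 'I_q -> 'S_n}) (\prod_k (-1) ^+ (f k)) *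
    \prod_p X p.1 p.2 ^+ perm_count f p.
Proof.
rewrite -[in LHS](card_ord q) -prodr_const.
rewrite (eq_bigl predT) // (bigA_distr_bigA (fun (k : 'I_q) (s : 'S_n) => (-1) ^+ s *
  \prod_i X i (s i))) /=.
apply: eq_bigr => f _; rewrite big_split /=; congr (_ * _).
under [RHS]eq_bigr => p _ do rewrite /perm_count -prodrXr.
rewrite [RHS]exchange_big; apply: eq_bigr => k _ /=.
rewrite -(pair_bigA _ (fun i j => X i j ^+ (f k i == j))) /=.
apply: eq_bigr => i _; rewrite (bigD1 (f k i)) //= eqxx expr1 big1 ?mulr1 //.
by move=> j; rewrite eq_sym => /negPf ->.
Qed.

Lemma avg_prod (K : comNzRingType) (A : finType) (v w : A -> K) (I : finType)
    (phi : I -> K -> K) :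
  avg v w (fun y => \prod_i phi i (y i)) = \prod_i wsum v w (phi i).
Proof.
rewrite /wsum (bigA_distr_bigA (fun i a => w a * phi i (v a))) /=.
by apply: eq_bigr => x _; rewrite -big_split.
Qed.

Lemma detm6_moments (K : comNzRingType) (A : finType) (v w : A -> K) (m : nat -> K) n :
    (forall k, (k <= 6)%N -> \sum_a w a * v a ^+ k = m k) ->
  detm6 v w n = \sum_(f : {ffun 'I_6 -> 'S_n}) (\prod_k (-1) ^+ (f k)) *
    \prod_p m (perm_count f p).
Proof.
move=> mw; transitivity (avg v w (fun y : 'I_n * 'I_n -> K =>
    \sum_(f : {ffun 'I_6 -> 'S_n}) (\prod_k (-1) ^+ (f k)) *
    \prod_p y p ^+ perm_count f p)).
  apply: eq_avg => y; rewrite det_exp_expand; apply: eq_bigr => f _.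
  by congr (_ * _); apply: eq_bigr => -[i j] _; rewrite mxE.
rewrite avg_sum; apply: eq_bigr => f _; rewrite avgZ.
rewrite (avg_prod v w (fun p x => x ^+ perm_count f p)); congr (_ * _).
by apply: eq_bigr => p _; rewrite /wsum mw // perm_count_le.
Qed.

(** * The determinant moment as a polynomial in the moments of the law *)

Section DetMoment.
Context (R : realType) (Omega : probability R R).
Hypothesis Omega_int : forall k : nat, (k <= 6)%N ->
  Omega.-integrable setT (fun x : R => (x ^+ k)%:E).
Context d (T : measurableType d) (P : probability T R).

Lemma moment_law (X : {RV P >-> R}) k : (k <= 6)%N ->
    (forall A : set R, measurable A -> distribution P X A = Omega A) ->
  P.-integrable setT (fun t => (X t ^+ k)%:E) /\
  fine (\int[P]_t (X t ^+ k)%:E)%E = moment Omega k.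
Proof.
move=> k6 lawX.
have mk : measurable_fun [set: R] (fun x : R => (x ^+ k)%:E).
  exact: measurable_int (Omega_int k6).
have XI : P.-integrable setT (fun t => (X t ^+ k)%:E).
  apply/integrableP; split; first exact: (measurableT_comp mk).
  have mak : measurable_fun [set: R] (fun x : R => `|(x ^+ k)%:E|%E).
    exact: measurableT_comp mk.
  rewrite -(ge0_integral_distribution X mak) => [|y]; last exact: abse_ge0.
  rewrite (eq_measure_integral Omega) => [|A mA _]; last exact: lawX.
  by case/integrableP: (Omega_int k6).
split=> //; rewrite /moment unlock; congr fine.
rewrite -(integral_distribution mk XI); apply: eq_measure_integral => A mA _.
exact: lawX.
Qed.

Lemma det_moment_moments n (M : 'I_n -> 'I_n -> {RV P >-> R}) :
    (forall (i j : 'I_n) (A : set R), measurable A ->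
       distribution P (M i j) A = Omega A) ->
    mutually_independent (fun ij : 'I_n * 'I_n => M ij.1 ij.2) ->
  det_moment M 6 = \sum_(f : {ffun 'I_6 -> 'S_n}) (\prod_k (-1) ^+ (f k)) *
    \prod_p moment Omega (perm_count f p).
Proof.
move=> M_law M_indep.
pose F (f : {ffun 'I_6 -> 'S_n}) t := \prod_p M p.1 p.2 t ^+ perm_count f p.
have FI f : P.-integrable setT (fun t => (F f t)%:E) /\
    (\int[P]_t (F f t)%:E = (\prod_p moment Omega (perm_count f p))%:E)%E.
  have [||FI FE] := @integral_prod_indep _ _ _ P _ _ M_indep
      (fun p x => x ^+ perm_count f p).
  - by move=> p; exact: measurable_funX.
  - by move=> p; have [] := moment_law (perm_count_le f p) (M_law p.1 p.2).
  split=> //; rewrite [LHS]FE; congr (_%:E); apply: eq_bigr => p _.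
  by have [] := moment_law (perm_count_le f p) (M_law p.1 p.2).
rewrite /det_moment unlock.
transitivity (fine (\int[P]_t (\sum_(f : {ffun 'I_6 -> 'S_n})
    ((\prod_k (-1) ^+ (f k))%R%:E * (F f t)%:E)))%E).
  congr fine; apply: eq_integral => t _.
  under [RHS]eq_bigr do rewrite -EFinM.
  rewrite sumEFin det_exp_expand; congr (_%:E); apply: eq_bigr => f _.
  by congr (_ * _); apply: eq_bigr => p _; rewrite mxE.
have fI (f : {ffun 'I_6 -> 'S_n}) : P.-integrable setT
    (fun t => ((\prod_k (-1) ^+ (f k))%R%:E * (F f t)%:E)%E).
  by apply: integrableZl => //; exact: (proj1 (FI f)).
rewrite integral_sum //.
under eq_bigr => f _.
  rewrite integralZl //; last exact: (proj1 (FI f)).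
  rewrite (proj2 (FI f)) -EFinM.
  over.
by rewrite sumEFin.
Qed.

End DetMoment.

(** * Coefficients of the closed form, and the theorem *)

Lemma coef_fpsM_sum (R : comNzRingType) (f : fps R) (s : nat -> fps R) n :
    (forall i m, (m < i)%N -> s i m = 0) ->
  (f * fps_sum s) n = \sum_(i < n.+1) (f * s i) n.
Proof.
move=> s0; rewrite -coef_fps_sum -mulr_sumr !coef_fpsM.
apply: eq_bigr => i _; congr (_ * _).
by rewrite fps_sum_stationary // ltnS leq_subr.
Qed.

Lemma coef_fpsXnM (R : comNzRingType) (f : fps R) i n : (i <= n)%N ->
  (fpsX ^+ i * f) n = f (n - i)%N.
Proof.
move=> ni; have iP : (i < n.+1)%N by [].
rewrite coef_fpsM (bigD1 (Ordinal iP)) //= coef_fpsXn eqxx mul1r.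
rewrite big1 ?addr0 // => j ji; rewrite coef_fpsXn.
by rewrite (_ : (_ == _) = false) ?mul0r //; apply: contraNF ji => /eqP ji; apply/eqP/val_inj.
Qed.

Lemma coef_closed_form (R : realType) (k4 k6 : R) n :
  (fps_exp (k6 *: fpsX) / (48 * (1 - k4 *: fpsX) ^+ 15)
   * fps_sum (fun i : nat => ((1 + i) * (2 + i) * (4 + i)`!)%:R *: fpsX ^+ i
       / (1 - k4 *: fpsX) ^+ (3 * i)) : fps R) n =
  \sum_(i < n.+1) ((1 + i) * (2 + i) * (4 + i)`!)%:R / 48 *
     exp_over_power k4 k6 (15 + 3 * i) (n - i)%N.
Proof.
set Q : fps R := 1 - k4 *: fpsX.
have Qu : Q \is a GRing.unit := fps_linear_unit k4.
rewrite coef_fpsM_sum => [|i m mi]; last first.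
  by rewrite -scalerAl coef_fpsZ coef_fpsXnM_lt ?mulr0.
apply: eq_bigr => i _.
(* As a series 48 is a constant, so its inverse is the scalar 1/48. *)
have u48 : (48 : fps R) = (48 : R)%:A by rewrite scaler_nat.
have V48 : (48 : fps R)^-1 = (48^-1 : R)%:A.
  by rewrite u48 -[_%:A]/(in_alg _ _) -fmorphV.
have U48 : (48 : fps R) \is a GRing.unit.
  by rewrite u48 -[_%:A]/(in_alg _ _) rmorph_unit // unitfE pnatr_eq0.
pose c : R := ((1 + i) * (2 + i) * (4 + i)`!)%:R; rewrite -/c.
transitivity (((c / 48) *: (fpsX ^+ i * exp_over_power k4 k6 (15 + 3 * i))) n); last first.
  by rewrite coef_fpsZ coef_fpsXnM // -ltnS.
congr (fps_coef _ n); rewrite /exp_over_power -/Q exprD.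
have := unitrX 15 Qu; have := unitrX (3 * i) Qu.
move: (Q ^+ 15) (Q ^+ (3 * i)) => a b bu au.
rewrite !invrM // V48 mulr_algr -!(scalerAl, scalerAr) scalerA.
rewrite [_ / 48]mulrC; congr (_ *: _).
have aux (S : comNzRingType) (x y z u : S) : x * y * (z * u) = z * (x * (u * y)).
  by ring.
exact: aux.
Qed.

Theorem theorem1 (R : realType) (Omega : probability R R)
    (Omega_int : forall k : nat, (k <= 6)%N ->
       Omega.-integrable setT (fun x : R => (x ^+ k)%:E))
    (m1 : moment Omega 1 = 0) (m3 : moment Omega 3 = 0)
    (m2 : moment Omega 2 = 1)
    (d : nat -> measure_display) (T : forall n, measurableType (d n))
    (P : forall n, probability (T n) R)
    (M : forall n, 'I_n -> 'I_n -> {RV (P n) >-> R})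
    (M_law : forall n (i j : 'I_n) (A : set R), measurable A ->
       distribution (P n) (M n i j) A = Omega A)
    (M_indep : forall n,
       mutually_independent (fun ij : 'I_n * 'I_n => M n ij.1 ij.2)) :
  let m4 := moment Omega 4 in
  let m6 := moment Omega 6 in
  let f6 n := det_moment (M n) 6 in
  let t : fps R := fpsX in
  let F6 : fps R := Fps (fun n => f6 n / (n`!%:R) ^+ 2) in
  F6 = fps_exp ((m6 - 15 * m4 + 30) *: t)
         / (48 * (1 + 3 *: t - m4 *: t) ^+ 15)
       * fps_sum (fun i : nat =>
           ((1 + i) * (2 + i) * (4 + i)`!)%:R *: t ^+ i
             / (1 + 3 *: t - m4 *: t) ^+ (3 * i)).
Proof.
move=> m4 m6 f6 t F6; apply: fpsP => n.
have -> : 1 + 3 *: t - m4 *: t = 1 - (m4 - 3) *: t.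
  by rewrite scalerBl opprB addrA.
rewrite coef_closed_form /F6 /= /f6.
(* [w0] carries the Gaussian moments and [w1] the difference between the target moments and
   these. *)
have [w0 w0P] := moment_weights 7 (fun k => nth 0 [:: 1; 0; 1; 0; 3; 0; 15 : R] k).
pose k4 := m4 - 3; pose k6 := m6 - 15 * m4 + 30.
have [w1 w1P] := moment_weights 7
  (fun k => nth 0 [:: 0; 0; 0; 0; k4; 0; 15 * k4 + k6 : R] k).
rewrite -(@detm6_solve R 'I_7 (fun a => a%:R) w0 w1 k4 k6 w0P w1P).
rewrite (det_moment_moments Omega_int (M_law n) (M_indep n)).
(* [m'] has fifth moment 0, whatever that of [Omega] is; [eq_prod_moments] absorbs the
   discrepancy. *)
pose m' k := nth 0 [:: 1; 0; 1; 0; m4; 0; m6] k.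
have m0 : moment Omega 0 = 1.
  rewrite /moment [X in fine X](_ : _ = 1%E) // -[RHS](expectation_cst Omega 1).
  by congr expectation; apply/funext => x; rewrite expr0.
rewrite (@detm6_moments _ _ _ _ m') => [|k k6']; last first.
  under eq_bigr do rewrite mulrDl.
  rewrite big_split /= w0P // w1P // /m'.
  case: k k6' => [|[|[|[|[|[|[|//]]]]]]] _ /=; rewrite ?add0r ?addr0 //.
    by rewrite /k4; ring.
  by rewrite /k4 /k6; ring.
congr (_ / _); apply: eq_bigr => f _; congr (_ * _).
apply: eq_prod_moments => // k k7.
by case: k k7 => [|[|[|[|[|[|[|//]]]]]]] _.
Qed.
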